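(* Let $n\ge 1$ and let $\lambda=\{\lambda_0<\lambda_1<\dots<\lambda_n\}$ be a set of distinct real numbers. The poset of faces of the manifold with corners $Q_n=M_{\mathrm{St}_n,\lambda}/T^n$ is isomorphic to the cluster-permutohedron $\mathcal{P}_{\mathrm{St}_n}$ of the star graph $\mathrm{St}_n$.
   Context: Rows and columns are indexed by $0,1,\dots,n$. A Hermitian arrow matrix is a Hermitian $(n+1)\times(n+1)$-matrix whose entries vanish outside the main diagonal, the row $0$ and the column $0$. $M_{\mathrm{St}_n,\lambda}$ is the smooth $2n$-manifold of Hermitian arrow matrices with spectrum $\lambda$. The torus $T^{n+1}$ of diagonal unitary matrices acts on it by conjugation, scalar matrices act trivially, and this gives a locally standard action of $T^n=T^{n+1}/\Delta(T^1)$; the orbit space $Q_n$ is a manifold with corners. Faces are ordered by inclusion, and $Q_n$ itself is counted as a face. The star graph $\mathrm{St}_n$ has vertex set $V=\{0,1,\dots,n\}$ and edges $\{0,1\},\dots,\{0,n\}$. Cluster-permutohedron: let $\Gamma$ be a graph on a finite vertex set $V$, $|V|=N$, and fix an $N$-element set $[N]$ (for $\mathrm{St}_n$ one takes $\{0,1,\dots,n\}$). For a partition $\mathcal{V}=\{V_1,\dots,V_k\}$ of $V$, two bijections $p_1,p_2\colon V\to[N]$ are $\mathcal{V}$-equivalent if $p_1=p_2\cdot\sigma$ for some $\sigma\in\Sigma_{V_1}\times\cdots\times\Sigma_{V_k}\subseteq\Sigma_V$. A class of $\mathcal{V}$-equivalent bijections is called a cluster submitted to $\mathcal{V}$. $\mathcal{P}_\Gamma$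 is the set of all clusters submitted to partitions of $V$ into vertex sets of connected components of subgraphs $\tilde\Gamma\subset\Gamma$ on the vertex set $V$. Partial order: a cluster $[p']$ submitted to the partition $\mathcal{V}'$ of a subgraph $\tilde\Gamma'$ is less than or equal to a cluster $[p]$ submitted to the partition $\mathcal{V}$ of a subgraph $\tilde\Gamma\supset\tilde\Gamma'$ (so that $\mathcal{V}'$ refines $\mathcal{V}$) if $p$ and $p'$ are $\mathcal{V}$-equivalent. *)

(* Defs.v *)
From HB Require Import structures.
From mathcomp Require Import all_boot all_order all_algebra all_fingroup.
From mathcomp Require Import sesquilinear spectral complex.
From mathcomp Require Import generic_quotient.
From mathcomp Require Import boolp classical_sets functions reals topology normedtype.
Set Implicit Arguments.
Unset Strict Implicit.
Unset Printing Implicit Defensive.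
Import Order.TTheory GRing.Theory Num.Theory.
Import numFieldNormedType.Exports.
Local Open Scope classical_set_scope.
Local Open Scope ring_scope.
Local Open Scope sesquilinear_scope.
Local Open Scope quotient_scope.

Definition poset_isomorphic (X Y : Type) (A : set X) (leX : X -> X -> Prop)
    (B : set Y) (leY : Y -> Y -> Prop) : Prop :=
  exists2 f : X -> Y, set_bij A B f &
    forall x y, A x -> A y -> (leX x y <-> leY (f x) (f y)).

(* A simple graph on V is a symmetric irreflexive relation e; its subgraphs on
   the same vertex set are the symmetric subrelations of e. *)
Section ClusterPermutohedron.
Variables (V L : finType) (e : rel V).

Definition subgraph (e' : rel V) : Prop := symmetric e' /\ subrel e' e.

Definition components (e' : rel V) : {set {set V}} :=
  equivalence_partition (connect e') [set: V]%SET.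

(* s belongs to the product of the groups of permutations of the blocks of P *)
Definition block_perm (P : {set {set V}}) (s : {perm V}) : Prop :=
  forall B : {set V}, B \in P -> (s @: B = B)%SET.

Definition partition_equiv (P : {set {set V}}) (p1 p2 : {ffun V -> L}) : Prop :=
  exists2 s : {perm V}, block_perm P s & forall x, p1 x = p2 (s x).

(* The first component is the partition to which the cluster is submitted, the
   second one is the class of equivalent bijections. *)
Definition cluster : Type := {set {set V}} * set {ffun V -> L}.

Definition cluster_permutohedron : set cluster :=
  [set c | exists e' : rel V, exists p : {ffun V -> L},
    [/\ subgraph e', bijective p, c.1 = components e' &
        c.2 = [set q | partition_equiv c.1 q p]]].

Definition cluster_le (c' c : cluster) : Prop :=
  exists e' : rel V, exists e1 : rel V,
    [/\ subgraph e1, subgraph e', subrel e' e1,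
        c'.1 = components e' /\ c.1 = components e1 &
        exists p' : {ffun V -> L}, exists p : {ffun V -> L},
          [/\ c'.2 p', c.2 p & partition_equiv c.1 p p']].

End ClusterPermutohedron.

Definition star_graph (n : nat) : rel 'I_n.+1 :=
  fun i j => (i == ord0) != (j == ord0).

(* A corner structure on Q is given by a set of charts (U, x), where x maps the
   open set U to the orthant R_{>=0}^n; the depth of a point is the number of
   coordinates of the point which vanish in a chart around it. *)
Section Faces.
Variables (R : realType) (n : nat) (Q : topologicalType).
Variable atlas : set (set Q * (Q -> 'rV[R]_n)).

Definition depth_stratum (k : nat) : set Q :=
  [set q | exists c, [/\ atlas c, c.1 q & #|[pred i | c.2 q ord0 i == 0]| = k]].

Definition open_faces : set (set Q) :=
  [set G | exists k : nat, exists2 q : Q, depth_stratum k q &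
    G = connected_component (depth_stratum k) q].

Definition faces : set (set Q) := [set closure G | G in open_faces].

End Faces.

(* The complex numbers R[i], packed so that the topology of their norm is
   found by inference. *)
Definition complexes (R : realType) : numClosedFieldType := R[i]%C.

Section IsospectralArrow.
Variables (R : realType) (n : nat) (lam : 'I_n.+1 -> R).
Local Notation C := (complexes R).
Local Notation "x %:C" := (real_complex R x : C).

Definition arrow_matrix (A : 'M[C]_n.+1) : Prop :=
  forall i j, i != j -> i != ord0 -> j != ord0 -> A i j = 0.

Definition isospectral_arrow : set 'M[C]_n.+1 :=
  [set A | [/\ A \is hermsymmx, arrow_matrix A &
    forall z : C, eigenvalue A z <-> exists i, z = (lam i)%:C]].

(* The topological space of these matrices, with the subspace topology. *)
Definition arrow_manifold : topologicalType := isospectral_arrow.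
Local Notation M := arrow_manifold.

Definition torus (m : nat) : set 'M[C]_m :=
  [set t | is_diag_mx t /\ t \is unitarymx].
Local Notation torus_conj t A := (t *m A *m t^t*).

Lemma torus1 m : torus (1%:M : 'M[C]_m).
Proof.
split; first by apply/is_diag_mxP => i j /negPf ij; rewrite mxE -val_eqE /= ij.
by apply/unitarymxP; rewrite trmx1 map_mx1 mulmx1.
Qed.

Lemma torusM m (t s : 'M[C]_m) : torus t -> torus s -> torus (t *m s).
Proof.
case=> /is_diag_mxP dt ut [/is_diag_mxP ds us]; split; last first.
  exact: mul_unitarymx.
apply/is_diag_mxP => i j ij; rewrite mxE big1 // => k _.
have [ik|ik] := eqVneq i k; first by rewrite -ik (ds _ _ ij) mulr0.
by rewrite dt ?mul0r.
Qed.

Lemma torusV m (t : 'M[C]_m) : torus t -> torus (t^t*).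
Proof.
case=> /is_diag_mxP dt ut; split; last by rewrite trmxC_unitary.
by apply/is_diag_mxP => i j ij; rewrite !mxE dt ?conjC0 // eq_sym.
Qed.

Definition same_orbit : rel M := fun A B =>
  `[< exists2 t, torus t & \val B = torus_conj t (\val A) >].

Lemma same_orbit_refl : reflexive same_orbit.
Proof.
move=> A; apply/asboolP; exists 1%:M; first exact: torus1.
by rewrite trmx1 map_mx1 mul1mx mulmx1.
Qed.

Lemma same_orbit_sym : symmetric same_orbit.
Proof.
have H A B : same_orbit A B -> same_orbit B A.
  move=> /asboolP[t tt e]; apply/asboolP; exists (t^t*); first exact: torusV.
  have ut : t^t* *m t = 1%:M by apply: mulmx1C; apply/unitarymxP; case: tt.
  by rewrite e trmxCK !mulmxA ut mul1mx -mulmxA ut mulmx1.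
by move=> A B; apply/idP/idP; exact: H.
Qed.

Lemma same_orbit_trans : transitive same_orbit.
Proof.
move=> B A D /asboolP[t tt et] /asboolP[s ts es]; apply/asboolP.
exists (s *m t); first exact: torusM.
by rewrite es et trmx_mul map_mxM !mulmxA.
Qed.

Canonical same_orbit_equiv :=
  EquivRel same_orbit same_orbit_refl same_orbit_sym same_orbit_trans.

Definition orbit_space : topologicalType :=
  quotient_topology {eq_quot same_orbit}.
Local Notation Q := orbit_space.

Definition orbit_proj (A : M) : Q := \pi_({eq_quot same_orbit})%qT A.

(* Continuous isomorphisms of T^{n+1} / (scalar matrices) with T^n, given as
   homomorphisms of T^{n+1}; the inverse is continuous by compactness. *)
Definition torus_iso (psi : 'M[C]_n.+1 -> 'M[C]_n) : Prop :=
  [/\ psi @` @torus n.+1 = @torus n,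
      forall t s, torus t -> torus s -> psi (t *m s) = psi t *m psi s,
      {within @torus n.+1, continuous psi} &
      forall t, torus t -> psi t = 1%:M <-> is_scalar_mx t].

(* (U, f) is a chart of the locally standard action: f is a homeomorphism of
   the invariant open set U onto an open subset of C^n, equivariant up to an
   isomorphism of the acting torus with T^n, where T^n acts on C^n by
   z |-> (t_1 z_1, ..., t_n z_n). *)
Definition locally_standard_chart (U : set M) (f : M -> 'rV[C]_n) : Prop :=
  [/\ open U /\ (forall A B, U A -> same_orbit A B -> U B),
      {within U, continuous f},
      set_inj U f,
      forall W, open W -> W `<=` U -> open (f @` W) &
      exists2 psi, torus_iso psi &
        forall t A B, torus t -> U A -> \val B = torus_conj t (\val A) ->
          f B = f A *m psi t].

(* The corner structure of the orbit space: C^n / T^n is the orthant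
   R_{>=0}^n, with quotient map z |-> (|z_1|, ..., |z_n|), so that a locally
   standard chart (U, f) induces a chart of the orbit space on U / T^n. *)
Definition orbit_atlas : set (set Q * (Q -> 'rV[R]_n)) :=
  [set c : set Q * (Q -> 'rV[R]_n) |
    exists U f, [/\ locally_standard_chart U f, c.1 = orbit_proj @` U &
      forall A, U A -> forall i, (c.2 (orbit_proj A) ord0 i)%:C = `|f A ord0 i|]].

Definition orbit_faces : set (set Q) := faces orbit_atlas.

End IsospectralArrow.

(* Main.v *)
Require Import Defs.
From HB Require Import structures.
From mathcomp Require Import all_boot all_order all_algebra all_fingroup.
From mathcomp Require Import ring lra.
From mathcomp Require Import complex generic_quotient.
From mathcomp Require Import boolp classical_sets functions cardinality reals.
From mathcomp Require Import topology normedtype realfun.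
Set Implicit Arguments.
Unset Strict Implicit.
Unset Printing Implicit Defensive.
Import Order.TTheory GRing.Theory Num.Theory.
Import numFieldNormedType.Exports.
Local Open Scope classical_set_scope.
Local Open Scope ring_scope.

(** Conjugation by diagonal unitary matrices keeps the diagonal of an arrow
    matrix A and multiplies its arms A_{i0} by independent phases.  The orbit of A
    is therefore determined by the nodes a_i = A_{ii} and the weights
    b_i = |A_{i0}|^2, i = 1, ..., n, and A has spectrum lam exactly when
      prod_m (X - lam_m) = (X - a_0) prod_i (X - a_i) - sum_i b_i prod_{l <> i} (X - a_l),
    where a_0 is fixed by the trace ([char_poly_arrow], [isospectral_arrowP]).  The
    orbit space is homeomorphic to the set [dataset] of the solutions (a, b) with
    b >= 0: a continuous section takes the arms equal to sqrt b_i
    ([orbit_data_inj], [orbit_data_continuous], [section_exists]).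

    A node of weight zero is an eigenvalue.  For a set N of columns and a bijection
    p from columns to eigenvalues, let the face [data_face] N p consist of the data
    with b_i = 0 and a_i = lam (p i) for all i outside N; it depends only on N and
    on the restriction of p to the columns outside N.  Its inner part, where b_i is
    nonzero on N, is [data_stratum] N p.  These are the faces of the orbit space
    ([orbit_facesE]), for three reasons.

    - The depth of a point is its number of zero weights ([depthE]).  Where the
      nodes are distinct, b_i = - p(a_i) / prod_{l <> i} (a_i - a_l) for the
      characteristic polynomial p, so the nodes are coordinates, and locally the weight is a
      positive multiple of the distance from a_i to an eigenvalue.  Two nodes, never
      three, may meet, only at an eigenvalue lam_k, and then one of the two
      coordinates is replaced by the ratio r in a_i - lam_k = - r (a_j - lam_k).
      Both cases are treated at once in [local_model], and give the charts of
      [chart_exists].  Any other chart has as many vanishing coordinates, because an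
      equivariant chart identifies stabilizers, and the 2-torsion of the stabilizer
      has 2^d elements at a point with d vanishing coordinates ([chart_zeros]).
    - Faces are connected ([data_face_connected]).  On a face, lower the smallest
      node of nonzero weight until its weight vanishes; if it coincides with another
      node, shift weight from one to the other.  Repetition leads to a vertex, where
      all weights vanish, and the vertices of a face are joined by edges along which
      the corner entry a_0 and one node exchange their eigenvalues.
    - A stratum is dense in its face and locally connected there ([local_faces]),
      hence connected ([dense_connected]), and so it is a component of the set of
      points of its depth ([depth_component]); its closure is the face.

    The face of (N', p') is contained in the face of (N, p) if and only if N' is a
    subset of N and p, p' agree outside N ([orbit_face_le]).  On the other side, the
    partition given by a subgraph of the star consists of the block made of the
    centre and a set N of leaves, and of singletons, so a cluster is a bijection p
    given outside N, and the order of clusters is the same relation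
    ([star_cluster_le]). *)

(** * The characteristic polynomial of an arrow matrix *)
Section Secular.
Variables (F : fieldType) (n : nat).
Implicit Types (a b : 'I_n -> F) (p : {poly F}).

(** The characteristic polynomial of an arrow matrix with corner a0, further
    diagonal entries a_i, and b_i the product of the two entries outside the diagonal
    in row and column i. *)
Definition secular (a0 : F) a b : {poly F} :=
  ('X - a0%:P) * \prod_i ('X - (a i)%:P)
  - \sum_i (b i)%:P * \prod_(l | l != i) ('X - (a l)%:P).

(** Multiplying on the right by a block matrix whose first column is the
    adjugate solution clears the column c at the cost of the factor prod_i d_i, which
    can be cancelled in a domain. *)
Lemma det_arrow (D : idomainType) (x : D) (d : 'I_n -> D) (r : 'rV[D]_n)
    (c : 'cV[D]_n) : \prod_i d i != 0 ->
  \det (block_mx x%:M r c (diag_mx (\row_i d i))) =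
  x * \prod_i d i - \sum_i r 0 i * c i 0 * \prod_(l | l != i) d l.
Proof.
move=> q0; set q := \prod_i d i in q0 *.
pose e := diag_mx (\row_i \prod_(l | l != i) d l).
have de : diag_mx (\row_i d i) *m e = q%:M.
  apply/matrixP => i j; rewrite /e mul_diag_mx !mxE; case: eqVneq => [->|_].
    by rewrite !mulr1n /q [RHS](bigD1 j).
  by rewrite mulr0.
have ec : (r *m e *m c) 0 0 = \sum_i r 0 i * c i 0 * \prod_(l | l != i) d l.
  rewrite mxE; apply: eq_bigr => i _; rewrite mul_mx_diag !mxE.
  by rewrite mulrAC.
apply: (mulIf q0).
have := det_mulmx (block_mx x%:M r c (diag_mx (\row_i d i)))
  (block_mx q%:M 0 (- (e *m c)) 1%:M).
rewrite det_lblock det1 mulr1 det_scalar expr1 => <-.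
rewrite mulmx_block !mulmx0 !mulmx1 !add0r !mulmxN !mulmxA de.
rewrite !mul_mx_scalar !mul_scalar_mx addrN det_ublock det_diag.
congr (_ * _); last by apply: eq_bigr => i _; rewrite mxE.
by rewrite det_mx11 -ec !mxE eqxx mulr1n mulrC.
Qed.

Lemma prod_XsubC_neq0 (I : finType) (P : pred I) (f : I -> F) :
  \prod_(i | P i) ('X - (f i)%:P) != 0.
Proof. by apply/prodf_neq0 => i _; rewrite polyXsubC_eq0. Qed.

Lemma char_poly_arrow (A : 'M[F]_n.+1) :
    (forall i j, i != j -> i != ord0 -> j != ord0 -> A i j = 0) ->
  char_poly A = secular (A 0 0) (fun i => A (lift ord0 i) (lift ord0 i))
    (fun i => A 0 (lift ord0 i) * A (lift ord0 i) 0).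
Proof.
move=> arr; pose d (i : 'I_n) := 'X - (A (lift ord0 i) (lift ord0 i))%:P.
pose r := \row_(i < n) (- (A 0 (lift ord0 i))%:P).
pose c := \col_(i < n) (- (A (lift ord0 i) 0)%:P).
have q0 : \prod_i d i != 0 by apply/prodf_neq0 => i _; rewrite polyXsubC_eq0.
have l0 : (lshift n 0 : 'I_(1 + n)) = 0 by apply/val_inj.
have rl i : (rshift 1 i : 'I_(1 + n)) = lift ord0 i by apply/val_inj.
rewrite /char_poly.
have -> : char_poly_mx A = block_mx ('X - (A 0 0)%:P)%:M r c (diag_mx (\row_i d i)).
  rewrite -[LHS](@submxK _ 1 n 1 n).
  have cong (a a' : 'M[{poly F}]_1) (b b' : 'rV_n) (e e' : 'cV_n) (f f' : 'M_n) :
    a = a' -> b = b' -> e = e' -> f = f' -> block_mx a b e f = block_mx a' b' e' f'.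
    by move=> -> -> -> ->.
  apply: cong; apply/matrixP => i j; rewrite ![in LHS]mxE ?ord1 ?l0 ?rl.
  - by rewrite !mxE !eqxx.
  - by rewrite !mxE sub0r.
  - by rewrite !mxE sub0r.
  rewrite !mxE /d (inj_eq lift_inj); case: eqVneq => [->//|ij].
  by rewrite (arr (lift ord0 i) (lift ord0 j)) ?(inj_eq lift_inj) // polyC0 subr0.
rewrite det_arrow // /secular; congr (_ - _); apply: eq_bigr => i _.
by rewrite !mxE mulrNN -polyCM.
Qed.

(** The secular polynomial is the characteristic polynomial of an arrow matrix,
    so that its two leading coefficients are 1 and minus the trace. *)
Lemma secular_coefs (a0 : F) a b :
  [/\ size (secular a0 a b) = n.+2, secular a0 a b \is monic &
      ((secular a0 a b)`_n = - (a0 + \sum_i a i))].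
Proof.
(* Only the product of the two outer entries matters: put b_j in the row and 1
   in the column. *)
pose A : 'M[F]_n.+1 := \matrix_(i, j)
  if unlift ord0 i is Some i' then
    if unlift ord0 j is Some j' then a i' *+ (i' == j') else 1
  else if unlift ord0 j is Some j' then b j' else a0.
have -> : secular a0 a b = char_poly A.
  rewrite char_poly_arrow; last first.
    move=> i j ij i0 j0; rewrite mxE; case: unliftP i0 ij => [i' ->|->//] _.
    case: unliftP j0 => [j' ->|->//] _; rewrite (inj_eq lift_inj).
    by move/negPf->.
  rewrite /secular mxE unlift_none; congr (_ * _ - _).
    by apply: eq_bigr => i _; rewrite !mxE liftK eqxx.
  apply: eq_bigr => i _; rewrite !mxE unlift_none liftK mulr1; congr (_ * _).
  by apply: eq_bigr => l _; rewrite !mxE liftK eqxx.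
split; [exact: size_char_poly|exact: char_poly_monic|].
rewrite -[n in _`_n]/(n.+1.-1) char_poly_trace //; congr (- _).
rewrite /mxtrace big_ord_recl mxE unlift_none; congr (_ + _).
by apply: eq_bigr => i _; rewrite mxE liftK eqxx.
Qed.

Lemma secular_node (a0 : F) a b i :
  (secular a0 a b).[a i] = - b i * \prod_(l | l != i) (a i - a l).
Proof.
rewrite /secular hornerD hornerN hornerM horner_prod (bigD1 i) //=.
rewrite !hornerXsubC subrr mul0r mulr0 sub0r horner_sum (bigD1 i) //= [X in _ + X]big1 ?addr0.
  rewrite hornerM horner_prod hornerC mulNr; congr (- (_ * _)).
  by apply: eq_bigr => l _; rewrite hornerXsubC.
move=> l li; rewrite hornerM horner_prod (bigD1 i) ?(eq_sym i) //=.
by rewrite hornerXsubC subrr mul0r mulr0.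
Qed.

(** When two nodes coincide, every term of the secular polynomial keeps one of
    the factors X - a_i, and only the sum of the two weights enters the quotient at a_i. *)
Lemma secular_double (a0 : F) a b i j : i != j -> a i = a j ->
  exists2 G : {poly F}, secular a0 a b = ('X - (a i)%:P) * G &
    G.[a i] = - (b i + b j) * \prod_(l | (l != i) && (l != j)) (a i - a l).
Proof.
move=> ij aij; pose h := \prod_(l | (l != i) && (l != j)) ('X - (a l)%:P).
exists (('X - a0%:P) * ('X - (a i)%:P) * h - (b i)%:P * h - (b j)%:P * h
  - \sum_(l | (l != i) && (l != j)) (b l)%:P * ('X - (a i)%:P) *
    \prod_(k | [&& k != l, k != i & k != j]) ('X - (a k)%:P)).
  have ji : j != i by rewrite eq_sym.
  have pi : \prod_(l | l != i) ('X - (a l)%:P) = ('X - (a i)%:P) * h.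
    by rewrite (bigD1 j) //= -aij.
  have pj : \prod_(l | l != j) ('X - (a l)%:P) = ('X - (a i)%:P) * h.
    by rewrite (bigD1 i) //=; congr (_ * _); apply: eq_bigl => l; rewrite andbC.
  rewrite /secular (bigD1 i) //= pi (bigD1 i) //= pi (bigD1 j) //= pj.
  rewrite !mulrBr mulr_sumr.
  have -> : \sum_(l < n | (l != i) && (l != j))
      (b l)%:P * \prod_(l0 < n | l0 != l) ('X - (a l0)%:P) =
    \sum_(l < n | (l != i) && (l != j)) ('X - (a i)%:P) *
      ((b l)%:P * ('X - (a i)%:P) *
      \prod_(k | [&& k != l, k != i & k != j]) ('X - (a k)%:P)).
    apply: eq_bigr => l /andP[li lj].
    rewrite (bigD1 i) 1?eq_sym //= [X in _ * (_ * X)](bigD1 j) /=; last first.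
      by rewrite eq_sym lj ji.
    rewrite -aij mulrCA !mulrA; congr (_ * _).
    by apply: eq_bigl => k; rewrite andbA.
  by set S := \sum_(_ < _ | _) _; ring.
have hE : h.[a i] = \prod_(l | (l != i) && (l != j)) (a i - a l).
  by rewrite /h horner_prod; apply: eq_bigr => l _; rewrite !hornerE.
rewrite !hornerE hE horner_sum [\sum_(_ < _ | _) _]big1; last first.
  by move=> l _; rewrite !hornerE subrr mulr0 mul0r.
by ring.
Qed.

(** Powers of distinct linear factors are coprime, so divisibility can be
    checked one root at a time. *)
Lemma dvdp_prod_XsubC_mult (s : seq F) p :
    (forall x, ('X - x%:P) ^+ (count_mem x s) %| p) ->
  \prod_(x <- s) ('X - x%:P) %| p.
Proof.
elim: s p => [|y s IH] p H; first by rewrite big_nil dvd1p.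
have := H y; rewrite /= eqxx exprS => /(dvdp_trans (dvdp_mulr _ (dvdpp _))).
move=> /dvdpP[q pE]; rewrite big_cons pE mulrC dvdp_mul2r ?polyXsubC_eq0 //.
apply: IH => x; have := H x; rewrite pE /=; have [->|yx] := eqVneq y x.
  by rewrite exprSr dvdp_mul2r ?polyXsubC_eq0.
rewrite add0n Gauss_dvdpl //; apply: coprimep_expl.
by rewrite coprimep_XsubC root_XsubC.
Qed.

(** Interpolation: with a_0 chosen by the trace, both sides share their two
    leading coefficients, so their difference has degree less than n.  The hypotheses
    make it divisible by prod_i (X - a_i), of degree n: the first one gives the simple
    roots, the second one the double root at two coincident nodes. *)
Lemma secular_reconstruct (lam : 'I_n.+1 -> F) a b :
    (forall i, \prod_m (a i - lam m) = - b i * \prod_(l | l != i) (a i - a l)) ->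
    (forall i j, i != j -> a i = a j -> exists k, [/\ lam k = a i,
       \prod_(m | m != k) (a i - lam m) =
         - (b i + b j) * \prod_(l | (l != i) && (l != j)) (a i - a l) &
       forall l, a l = a i -> l = i \/ l = j]) ->
  \prod_m ('X - (lam m)%:P) = secular (\sum_m lam m - \sum_i a i) a b.
Proof.
move=> H1 H2; set a0 := _ - _; set p := \prod_m _.
have [ss sm sc] := secular_coefs a0 a b.
have ps : size p = n.+2 by rewrite /p size_prod_XsubC [index_enum _]unlock -enumT size_enum_ord.
have pm : p \is monic by exact: monic_prod_XsubC.
have pc : p`_n = - \sum_m lam m.
  have := @coefPn_prod_XsubC _ [seq lam m | m <- enum 'I_n.+1].
  rewrite size_map size_enum_ord !big_map. exact.
apply/eqP; rewrite -subr_eq0; set d := p - _.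
have szd : (size d <= n)%N.
  apply/leq_sizeP => j; rewrite leq_eqVlt => /predU1P[<-|].
    by rewrite coefB pc sc /a0; ring.
  rewrite leq_eqVlt => /predU1P[<-|jn].
    have := monicP sm; have := monicP pm; rewrite !lead_coefE ps ss /= => e1 e2.
    by rewrite coefB e1 e2 subrr.
  by rewrite coefB !nth_default ?subrr ?ss ?ps.
pose s := [seq a i | i <- enum 'I_n].
suff : \prod_(x <- s) ('X - x%:P) %| d.
  apply: contraTT => d0; apply: contraTN szd => /dvdp_leq -/(_ d0).
  by rewrite size_prod_XsubC size_map size_enum_ord -ltnNge.
have root1 i : root d (a i).
  rewrite rootE /d hornerD hornerN secular_node -H1 /p horner_prod subr_eq0.
  by apply/eqP; apply: eq_bigr => m _; rewrite !hornerE.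
apply: dvdp_prod_XsubC_mult => x.
have cE : count_mem x s = #|[pred i | a i == x]|.
  by rewrite count_map cardE size_filter -enumT; apply: eq_count.
case: (pickP [pred i | a i == x]) => [i /eqP ai|none]; last first.
  by rewrite cE (eq_card0 none) expr0 dvd1p.
case: (pickP [pred j | (j != i) && (a j == x)]) => [j /andP[ji /eqP aj]|one];
  last first.
  rewrite cE (eq_card (B := pred1 i)) ?card1 ?expr1 ?dvdp_XsubCl -?ai //.
  by move=> j; have := one j; rewrite /= !inE; case: eqVneq => [->|_] /=; rewrite ?ai ?eqxx.
have [|k [lk Ek two]] := H2 i j _ (etrans ai (esym aj)); first by rewrite eq_sym.
have -> : count_mem x s = 2%N.
  rewrite cE (eq_card (B := pred2 i j)) ?card2 1?eq_sym ?ji // => l.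
  rewrite !inE; apply/eqP/orP => [al|]; last by case=> /eqP->.
  by have [->|->] := two l (etrans al (esym ai)); rewrite eqxx; [left|right].
have [|G sG Gx] := secular_double a0 b _ (etrans ai (esym aj)); first by rewrite eq_sym.
have -> : d = ('X - (a i)%:P) * (\prod_(m | m != k) ('X - (lam m)%:P) - G).
  by rewrite /d sG /p (bigD1 k) //= lk mulrBr.
rewrite ai expr2 dvdp_mul2l ?polyXsubC_eq0 // dvdp_XsubCl rootE -ai hornerD hornerN.
rewrite Gx -Ek horner_prod subr_eq0; apply/eqP.
by apply: eq_bigr => m _; rewrite !hornerE.
Qed.

(** An isospectral deformation which moves one node a_i to t and keeps the other
    nodes.  The values at the fixed nodes a_l force the new b_l, the trace forces the new
    corner, and what is then left over is a constant times prod_{l <> i} (X - a_l), which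
    the new b_i absorbs.  A fixed node of weight zero may be crossed, its weight
    remaining zero. *)
Lemma secular_shift (a0 : F) a b i t :
    (forall l, l != i -> b l != 0 -> a l != t) ->
  let a' := fun l => if l == i then t else a l in
  let a0' := a0 + a i - t in
  let b' := fun l => if l == i then
     a0' * t - a0 * a i + b i - \sum_(l | l != i) b l * (t - a i) / (a l - t)
     else b l * (a l - a i) / (a l - t) in
  secular a0' a' b' = secular a0 a b.
Proof.
move=> H a' a0' b'; pose h := \prod_(l | l != i) ('X - (a l)%:P).
pose hl l := \prod_(k | (k != l) && (k != i)) ('X - (a k)%:P).
have prodE (f : 'I_n -> F) : \prod_l ('X - (f l)%:P) =
    ('X - (f i)%:P) * \prod_(l | l != i) ('X - (f l)%:P).
  by rewrite (bigD1 i).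
have secE c (f g : 'I_n -> F) : (forall l, l != i -> f l = a l) ->
  secular c f g = (('X - c%:P) * ('X - (f i)%:P) - (g i)%:P) * h -
     \sum_(l | l != i) (g l)%:P * ('X - (f i)%:P) * hl l.
  move=> fa; have fh : \prod_(l | l != i) ('X - (f l)%:P) = h.
    by apply: eq_bigr => l li; rewrite fa.
  rewrite /secular prodE fh [\sum_l _](bigD1 i) //= fh opprD addrA mulrA -mulrBl.
  congr (_ - _); apply: eq_bigr => l li.
  rewrite (bigD1 i) 1?eq_sym //= mulrA; congr (_ * _).
  by apply: eq_bigr => k /andP[_ ki]; rewrite fa.
rewrite !secE // /a' /b' ?eqxx; last by move=> l /negPf->.
(* The sum over l <> i changes by kap * h. *)
set kap := \sum_(l | _) _ * _ / _.
have hE : kap%:P * h = \sum_(l | l != i)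
    ((b l * (a l - a i) / (a l - t))%:P * ('X - t%:P) * hl l -
    (b l)%:P * ('X - (a i)%:P) * hl l).
  rewrite /kap raddf_sum mulr_suml; apply: eq_bigr => l li.
  have -> : h = ('X - (a l)%:P) * hl l.
    by rewrite /h (bigD1 l) //=; congr (_ * _); apply: eq_bigl => k; rewrite andbC.
  rewrite mulrA -mulrBl; congr (_ * _).
  have [->|bl] := eqVneq (b l) 0; first by rewrite !(mul0r, polyC0, subrr).
  have at0 : a l - t != 0 by rewrite subr_eq0 H.
  have E : b l * (a l - a i) / (a l - t) = b l + b l * (t - a i) / (a l - t).
    by field.
  have E2 : b l * (t - a i) = (b l * (t - a i) / (a l - t)) * (a l - t) by field.
  rewrite E; set v := b l * _ / _ in E2 *.
  have : (b l)%:P * (t%:P - (a i)%:P) = v%:P * ((a l)%:P - t%:P).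
    by rewrite -!polyCB -!polyCM E2.
  move=> E3; rewrite polyCD.
  transitivity ((b l)%:P * ((a i)%:P - t%:P) + v%:P * ('X - t%:P)); last by ring.
  by rewrite -[(a i)%:P - _]opprB mulrN E3; ring.
rewrite (eq_bigr (fun l => (b l * (a l - a i) / (a l - t))%:P * ('X - t%:P) * hl l));
  last by move=> l /negPf->.
have -> : \sum_(l | l != i) (b l * (a l - a i) / (a l - t))%:P * ('X - t%:P) * hl l =
   kap%:P * h + \sum_(l | l != i) (b l)%:P * ('X - (a i)%:P) * hl l.
  by rewrite hE -big_split /=; apply: eq_bigr => l _; rewrite subrK.
set S := \sum_(l | _) _; rewrite /a0' !(polyCD, polyCB, polyCM, polyCN); ring.
Qed.

End Secular.

(** * Nodes and weights with a given spectrum *)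
Section Spectral.
Variables (R : realFieldType) (n : nat) (lam : 'I_n.+1 -> R).
Hypothesis lam_inj : injective lam.
Implicit Types (a b r : 'I_n -> R).

Definition spectral a b :=
  \prod_m ('X - (lam m)%:P) = secular (\sum_m lam m - \sum_i a i) a b.

Lemma spectral_node a b i : spectral a b ->
  \prod_m (a i - lam m) = - b i * \prod_(l | l != i) (a i - a l).
Proof.
move=> H; rewrite -(secular_node (\sum_m lam m - \sum_i a i)) -H horner_prod.
by apply: eq_bigr => m _; rewrite hornerXsubC.
Qed.

(** The double node is a root, hence some eigenvalue lam_k; cancel X - lam_k on
    both sides and evaluate again. *)
Lemma spectral_double a b i j : spectral a b -> i != j -> a i = a j ->
  exists2 k, lam k = a i & \prod_(m | m != k) (a i - lam m) =
    - (b i + b j) * \prod_(l | (l != i) && (l != j)) (a i - a l).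
Proof.
move=> H ij aij; have := spectral_node i H.
rewrite [in RHS](bigD1 j) 1?eq_sym //= aij subrr mul0r mulr0.
move=> /eqP/prodf_eq0[k _]; rewrite subr_eq0 => /eqP ak; exists k => //.
have [G sG Gx] := secular_double (\sum_m lam m - \sum_i a i) b ij aij.
rewrite -aij -Gx; move: H; rewrite /spectral sG (bigD1 k) //= -ak -aij.
move=> /(mulfI (negbT (polyXsubC_eq0 _))) <-; rewrite horner_prod.
by apply: eq_bigr => m _; rewrite hornerXsubC.
Qed.

(** As lam_k is a simple eigenvalue, the left-hand side of the second equation
    of [spectral_double] does not vanish, and so no factor of its right-hand side does. *)
Lemma spectral_double_neq0 a b i j : spectral a b -> i != j -> a i = a j ->
  b i + b j != 0 /\ forall l, a l = a i -> l = i \/ l = j.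
Proof.
move=> H ij aij; have [k ak E] := spectral_double H ij aij.
have : \prod_(m | m != k) (a i - lam m) != 0.
  by apply/prodf_neq0 => m mk; rewrite subr_eq0 -ak (inj_eq lam_inj) eq_sym.
rewrite E mulf_eq0 oppr_eq0 negb_or => /andP[-> /prodf_neq0 N]; split=> // l al.
have [->|li] := eqVneq l i; first by left.
have [->|lj] := eqVneq l j; first by right.
by have := N l; rewrite li lj al subrr eqxx => /(_ isT).
Qed.

(** Coordinates around the data (u, w).  For a node u_i different from all others the
    coordinate is, up to sign, its distance to an eigenvalue, which is the eigenvalue
    u_i itself whenever u_i is one.  Two coincident nodes i and j sit at an eigenvalue
    lam_k, and at least one of them, say j, has nonzero weight.  For j one takes the
    distance to some other eigenvalue, and for i the ratio r given by
    a_i - lam_k = - r (a_j - lam_k); it is proportional to b_i / b_j and therefore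
    vanishes exactly with b_i.  In all cases b_i is the coordinate times a positive
    function. *)
Section LocalModel.
Hypothesis n_gt0 : (0 < n)%N.
Variables u w : 'I_n -> R.
Hypotheses (uw : spectral u w) (w_ge0 : forall i, 0 <= w i).

(** The other index with the same node, and i itself if there is none. *)
Definition mate i := if [pick j | (j != i) && (u j == u i)] is Some j then j else i.

Lemma mate_node i : u (mate i) = u i.
Proof. by rewrite /mate; case: pickP => // j /andP[_ /eqP]. Qed.

Lemma mate_uniq i l : u l = u i -> l = i \/ l = mate i.
Proof.
rewrite /mate; case: pickP => [j /andP[ji /eqP uj] ul|N ul].
  by apply: (spectral_double_neq0 uw _ (esym uj)).2 => //; rewrite eq_sym.
by left; apply/eqP; have := N l; rewrite /= ul eqxx andbT => /negbFE.
Qed.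

Lemma mateK : involutive mate.
Proof.
move=> i; have [e|//] := mate_uniq (esym (mate_node i)).
by rewrite -e -e.
Qed.

(** The index of a coincident pair whose coordinate is a ratio.  It is chosen
    such that its mate has nonzero weight; ties are broken by the order of indices. *)
Definition secondary i :=
  (mate i != i) && ((w i == 0) || (w (mate i) != 0) && (i < mate i)%N).

Lemma mate_weight_gt0 i : mate i != i -> 0 < w i + w (mate i).
Proof.
move=> mi; rewrite lt_def addr_ge0 // andbT.
apply: (spectral_double_neq0 uw _ _).1; last by rewrite mate_node.
by rewrite eq_sym.
Qed.

Lemma secondary_mated i : secondary i -> mate i != i. Proof. by case/andP. Qed.

(** The two weights of a pair do not both vanish. *)
Lemma secondary_mate i : mate i != i -> secondary (mate i) = ~~ secondary i.
Proof.
move=> mi; rewrite /secondary mateK mi eq_sym mi /=; have := mate_weight_gt0 mi.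
have [->|wi] /= := eqVneq (w i) 0; first by rewrite add0r orbF => /gt_eqF->.
have [//|_] /= := eqVneq (w (mate i)) 0.
by move=> _; rewrite -leqNgt [RHS]leq_eqVlt val_eqE (negPf mi).
Qed.

(** The eigenvalue equal to the node u_i; the default value is met for single
    nodes only, where any eigenvalue can serve as the origin of the coordinate. *)
Definition root_at i := odflt ord0 [pick l | lam l == u i].

Lemma root_at_mate i : root_at (mate i) = root_at i.
Proof. by rewrite /root_at mate_node. Qed.

Lemma root_atP i l : lam l = u i -> root_at i = l.
Proof.
rewrite /root_at => e; case: pickP => [k /eqP ek|/(_ l)] /=.
  by apply: lam_inj; rewrite e.
by rewrite e eqxx.
Qed.

Lemma root_at_mated i : mate i != i -> lam (root_at i) = u i.
Proof.
move=> mi; have [||k ek _] := @spectral_double _ _ i (mate i) uw; rewrite 1?eq_sym ?mate_node //.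
by rewrite (root_atP ek).
Qed.

(** The eigenvalue from which the node is measured.  Inside a coincident pair it
    has to differ from the common eigenvalue, so that the coordinate of the index with
    nonzero weight does not vanish. *)
Definition anchor i : 'I_n.+1 :=
  if mate i == i then root_at i else if root_at i == ord0 then ord_max else ord0.

Lemma anchor_neq_root i : mate i != i -> anchor i != root_at i.
Proof.
move=> mi; rewrite /anchor (negPf mi); have [->|] := eqVneq (root_at i) ord0;
  last by rewrite eq_sym.
by rewrite -val_eqE /= -lt0n.
Qed.

(** The eigenvalues which do not contribute to [kept_roots]: their factors
    a_i - lam_m are expressed by the coordinates instead. *)
Definition factored i : pred 'I_n.+1 := fun m =>
  if mate i == i then m == anchor i else (m == root_at i) || ~~ secondary i && (m == anchor i).

Definition kept_roots i (z : R) := \prod_(m | ~~ factored i m) (z - lam m).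
Definition gaps a i := \prod_(l | (l != i) && (l != mate i)) (a i - a l).

(** The factor of b_i = - prod_m (a_i - lam_m) / prod_{l <> i} (a_i - a_l) which
    stays away from zero near the base point. *)
Definition quot a i := - kept_roots i (a i) / gaps a i.

(** The side of the anchor on which the node has to lie for b_i to be positive;
    the ratio coordinate of a secondary index needs no sign. *)
Definition side i : R := if secondary i then 1 else if 0 < quot u i then 1 else -1.
Definition node_of r i :=
  if secondary i then
    lam (root_at i) -
    r i * (lam (anchor (mate i)) + side (mate i) * r (mate i) - lam (root_at i))
  else lam (anchor i) + side i * r i.

(** With r the ratio coordinate of a pair, the two weights are r / (1 + r) and
    1 / (1 + r) times the respective values of [pair_quot]. *)
Definition share r i :=
  if mate i == i then 1 else if secondary i then (1 + r i)^-1 else (1 + r (mate i))^-1.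
Definition weight_factor r i := side i * quot (node_of r) i * share r i.

(** For a secondary index this is b_i / b_j rescaled by the two values of [pair_quot],
    which gives the ratio of the distances from the two nodes to their root. *)
Definition coord_of a b i :=
  if secondary i then b i * (quot a (mate i) * (a (mate i) - lam (anchor (mate i)))) /
    (b (mate i) * quot a i)
  else side i * (a i - lam (anchor i)).

(** The conditions, open and true at the base point, under which the passage
    from coordinates to data is defined and correct. *)
Definition good_coords_at r (i : 'I_n) :=
  [/\ 0 < weight_factor r i, gaps (node_of r) i != 0,
  secondary i -> 1 + r i != 0 & mate i != i -> ~~ secondary i -> r i != 0].
Definition good_coords r := forall i, good_coords_at r i.

(** The corresponding conditions for the passage from data to coordinates. *)
Definition good_data_at a b (i : 'I_n) := [/\ gaps a i != 0, kept_roots i (a i) != 0,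
  mate i != i -> forall l : 'I_n.+1, l != root_at i -> a i != lam l &
  mate i != i -> ~~ secondary i -> b i != 0].
Definition good_data a b := forall i, good_data_at a b i.

Lemma side_sqr i : side i * side i = 1.
Proof. by rewrite /side; case: ifP => _; [|case: ifP => _]; rewrite ?mulrNN mulr1. Qed.

Lemma side_neq0 i : side i != 0.
Proof. by apply/eqP => e; have := side_sqr i; rewrite e mul0r => /esym/eqP; rewrite oner_eq0. Qed.

Lemma gaps_distinct a i l : gaps a i != 0 -> a l = a i -> l = i \/ l = mate i.
Proof.
move=> /prodf_neq0 N al; have [->|li] := eqVneq l i; first by left.
have [->|lj] := eqVneq l (mate i); first by right.
by have := N l; rewrite li lj al subrr eqxx => /(_ isT).
Qed.

Lemma prod_single a i : mate i = i ->
  \prod_(l | l != i) (a i - a l) = gaps a i.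
Proof. by move=> mi; apply: eq_bigl => l; rewrite mi andbb. Qed.

Lemma prod_mated a i : mate i != i ->
  \prod_(l | l != i) (a i - a l) = (a i - a (mate i)) * gaps a i.
Proof. by move=> mi; rewrite (bigD1 (mate i)). Qed.

Lemma root_single i z : mate i = i -> \prod_m (z - lam m) = (z - lam (anchor i)) * kept_roots i z.
Proof.
move=> mi; rewrite (bigD1 (anchor i)) //=; congr (_ * _).
by apply: eq_bigl => l; rewrite /factored mi eqxx.
Qed.

Definition simple_roots i (z : R) := \prod_(m | m != root_at i) (z - lam m).

Lemma root_mated i z : \prod_m (z - lam m) = (z - lam (root_at i)) * simple_roots i z.
Proof. by rewrite (bigD1 (root_at i)). Qed.

Lemma simple_rootsE i z : mate i != i ->
  simple_roots i z = (if secondary i then 1 else z - lam (anchor i)) * kept_roots i z.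
Proof.
move=> mi; case: ifP => si.
  by rewrite mul1r; apply: eq_bigl => m; rewrite /factored (negPf mi) si orbF.
rewrite /simple_roots (bigD1 (anchor i)) ?anchor_neq_root //=; congr (_ * _).
by apply: eq_bigl => m; rewrite /factored (negPf mi) si negb_or.
Qed.

Lemma gaps_mate a i : a (mate i) = a i -> gaps a (mate i) = gaps a i.
Proof. by move=> ai; rewrite /gaps mateK ai; apply: eq_bigl => l; rewrite andbC. Qed.

Lemma quot_ext a a' i : a =1 a' -> quot a i = quot a' i.
Proof. by move=> e; rewrite /quot /gaps e; congr (_ / _); apply: eq_bigr => l _; rewrite e. Qed.

(** The number s_i with b_i = s_i * pair_quot_i. *)
Definition pair_share r i := if secondary i then r i / (1 + r i) else (1 + r (mate i))^-1.

(** For a pair i, j at the root lam_k, the relation a_i - lam_k = - r (a_j - lam_k)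
    reads a_i - lam_k = s_i (a_i - a_j), with s_i + s_j = 1.  Hence in the equation for
    b_i at the node a_i the factor a_i - a_j cancels, and what remains is meaningful when
    the two nodes coincide. *)
Lemma pair_share_eqs r i : good_coords r -> mate i != i ->
  [/\ r i * weight_factor r i * gaps (node_of r) i =
        - pair_share r i * simple_roots i (node_of r i),
      pair_share r i * (node_of r i - node_of r (mate i)) = node_of r i - lam (root_at i) &
      pair_share r i + pair_share r (mate i) = 1].
Proof.
move=> gv mi; have [_ Q0 _ _] := gv i; have mmi : mate (mate i) != mate i by rewrite mateK eq_sym.
split.
- rewrite simple_rootsE // /weight_factor /quot /share (negPf mi) /pair_share; case: ifP => si.
    have [_ _ /(_ si) r1 _] := gv i.
    by rewrite /side si mul1r; field; rewrite Q0 r1.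
  have [_ _ + _] := gv (mate i); rewrite secondary_mate // si => /(_ isT) r1.
  have -> : node_of r i - lam (anchor i) = side i * r i by rewrite /node_of si addrC addKr.
  by field; rewrite Q0 r1.
- rewrite /pair_share /node_of secondary_mate //; case: ifP => si /=.
    by have [_ _ /(_ si) r1 _] := gv i; field.
  have [_ _ + _] := gv (mate i); rewrite secondary_mate // si => /(_ isT) r1.
  by rewrite mateK root_at_mate; field.
- rewrite /pair_share secondary_mate // mateK; case: ifP => si /=.
    by have [_ _ /(_ si) r1 _] := gv i; field.
  by have [_ _ + _] := gv (mate i); rewrite secondary_mate // si => /(_ isT) r1; field.
Qed.

(** This is [secular_reconstruct]: the equations of [pair_share_eqs] give the
    value at each node, and their sum gives the derivative condition at a double node. *)
Lemma node_of_spectral r : good_coords r ->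
  spectral (node_of r) (fun i => r i * weight_factor r i).
Proof.
move=> gv; apply: secular_reconstruct => [i|i j ij aij].
  have [_ Q0 _ _] := gv i; have [mi|mi] := eqVneq (mate i) i.
    rewrite prod_single // (root_single _ mi).
    rewrite /weight_factor /share mi eqxx /quot.
    have -> : node_of r i - lam (anchor i) = side i * r i.
      have si : secondary i = false by rewrite /secondary mi eqxx.
      by rewrite /node_of si addrC addKr.
    by field.
  have [E1 E2 _] := pair_share_eqs gv mi.
  rewrite prod_mated // (root_mated i) -E2.
  transitivity (- (node_of r i - node_of r (mate i)) * (- pair_share r i * simple_roots i
    (node_of r i))).
    by ring.
  by rewrite -E1; ring.
have [_ Q0 _ _] := gv i.
have mj : j = mate i.
  by have [e|//] := gaps_distinct Q0 (esym aij); rewrite e eqxx in ij.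
have mi : mate i != i by rewrite -mj eq_sym.
have [E1 E2 E3] := pair_share_eqs gv mi.
have mmi : mate (mate i) != mate i by rewrite mateK eq_sym.
have [F1 F2 F3] := pair_share_eqs gv mmi.
rewrite -!mj in E1 E2 E3 F1 F2 F3 *.
have kE : lam (root_at i) = node_of r i.
  by apply/esym/eqP; rewrite -subr_eq0 -E2 aij subrr mulr0.
exists (root_at i); split=> //; last by move=> l; rewrite mj; exact: gaps_distinct.
have QE : gaps (node_of r) j = gaps (node_of r) i by rewrite mj gaps_mate // -mj aij.
have -> : \prod_(l | (l != i) && (l != j)) (node_of r i - node_of r l) = gaps (node_of r) i.
  by rewrite /gaps mj.
have PE : simple_roots j (node_of r j) = simple_roots i (node_of r i) by rewrite
  /simple_roots mj root_at_mate -mj aij.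
rewrite -/(simple_roots i _) mulNr mulrDl E1 -QE F1 PE -mulrDl -opprD E3.
by rewrite mulN1r opprK.
Qed.

Lemma coord_of_node r i : good_coords r ->
  coord_of (node_of r) (fun i => r i * weight_factor r i) i = r i.
Proof.
move=> gv; rewrite /coord_of; case: ifP => si; last first.
  by rewrite /node_of si [_ + _ * _]addrC addrK mulrA side_sqr mul1r.
have mi := secondary_mated si.
have sj : secondary (mate i) = false by rewrite secondary_mate // si.
have mj : mate (mate i) != mate i by rewrite mateK eq_sym.
have [Ti Qi /(_ si) ri _] := gv i; have [Tj Qj _ /(_ mj)] := gv (mate i).
rewrite sj => /(_ isT) rj.
have -> : node_of r (mate i) - lam (anchor (mate i)) = side (mate i) * r (mate i).
  by rewrite /node_of sj addrC addKr.
have si1 : side i = 1 by rewrite /side si.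
move: Ti Tj; rewrite /weight_factor /share (negPf mi) (negPf mj) si sj mateK si1 mul1r.
move=> Ti Tj.
have Ki : quot (node_of r) i != 0 by apply: contraTneq Ti => ->; rewrite mul0r ltxx.
have Kj : quot (node_of r) (mate i) != 0.
  by apply: contraTneq Tj => ->; rewrite mulr0 mul0r ltxx.
have := side_neq0 (mate i) => s0.
by field; rewrite ri s0 Ki Kj rj.
Qed.

Definition pair_quot a i := - simple_roots i (a i) / gaps a i.

Lemma pair_quot_neq0 a b i : good_data a b -> mate i != i -> pair_quot a i != 0.
Proof.
move=> gw mi; have [Q0 _ /(_ mi) N _] := gw i.
rewrite mulf_neq0 ?invr_eq0 // oppr_eq0; apply/prodf_neq0 => m mk.
by rewrite subr_eq0 N.
Qed.

Lemma pair_quotE a i : mate i != i ->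
  pair_quot a i = (if secondary i then 1 else a i - lam (anchor i)) * quot a i.
Proof. by move=> mi; rewrite /pair_quot simple_rootsE // /quot !mulrA mulrN. Qed.

(** The converse of [pair_share_eqs]: the quotients s = b / pair_quot of spectral
    data satisfy the same two equations, by [spectral_double] where the nodes coincide and
    by solving the two equations at the nodes where they do not. *)
Lemma pair_data a b i : spectral a b -> good_data a b -> mate i != i ->
  b i / pair_quot a i + b (mate i) / pair_quot a (mate i) = 1 /\
  a i - lam (root_at i) = b i / pair_quot a i * (a i - a (mate i)).
Proof.
move=> sp gw mi; have mj : mate (mate i) != mate i by rewrite mateK eq_sym.
have Ki := pair_quot_neq0 gw mi; have Kj := pair_quot_neq0 gw mj.
have [Qi _ /(_ mi) Ni _] := gw i; have [Qj _ _ _] := gw (mate i).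
have Pi : simple_roots i (a i) != 0.
  by apply/prodf_neq0 => m mk; rewrite subr_eq0 Ni.
have Pj : simple_roots (mate i) (a (mate i)) != 0.
  have [_ _ /(_ mj) Nj _] := gw (mate i).
  by apply/prodf_neq0 => m mk; rewrite subr_eq0 Nj.
have [aij|aij] := eqVneq (a (mate i)) (a i).
  have [||k ak E] := @spectral_double _ _ i (mate i) sp; rewrite 1?eq_sym //.
  have kE : k = root_at i.
    by apply/eqP; apply: contraTT isT => /Ni; rewrite ak eqxx.
  rewrite aij subrr mulr0 -kE ak subrr; split=> //.
  have QE : gaps a (mate i) = gaps a i by rewrite gaps_mate.
  have -> : pair_quot a (mate i) = pair_quot a i by rewrite /pair_quot QE /simple_roots
    root_at_mate aij.
  rewrite -mulrDl; rewrite kE -/(simple_roots i _) -/(gaps a i) in E.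
  apply: (mulIf Ki); rewrite mul1r divfK // /pair_quot E; field.
  exact: Qi.
have nodeE l : mate l != l -> (a l - lam (root_at l)) = b l / pair_quot a l * (a l - a (mate l)).
  move=> ml; have [Ql _ /(_ ml) Nl _] := gw l.
  have Pl : simple_roots l (a l) != 0 by apply/prodf_neq0 => m mk; rewrite subr_eq0 Nl.
  have := spectral_node l sp; rewrite prod_mated // (root_mated l) => E.
  apply: (mulIf Pl); rewrite E /pair_quot; field.
  by rewrite Ql Pl.
have Ei := nodeE i mi; split=> //; have := nodeE _ mj; rewrite mateK root_at_mate => Ej.
have d0 : a i - a (mate i) != 0 by rewrite subr_eq0 eq_sym.
apply: (mulIf d0); rewrite mul1r mulrDl -Ei -[a i - a (mate i)]opprB mulrN -Ej; ring.
Qed.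

(** The ratio coordinate is r = s_i / s_j, in the notation of [pair_data]. *)
Lemma coord_secondary a b i : spectral a b -> good_data a b -> secondary i ->
  let ti := b i / pair_quot a i in let tj := b (mate i) / pair_quot a (mate i) in
  coord_of a b i = ti / tj /\ tj != 0.
Proof.
move=> sp gw si; have mi := secondary_mated si; rewrite /coord_of si.
have mj : mate (mate i) != mate i by rewrite mateK eq_sym.
have sj : secondary (mate i) = false by rewrite secondary_mate // si.
have Ki := pair_quot_neq0 gw mi; have Kj := pair_quot_neq0 gw mj.
have [_ _ _ /(_ mj)] := gw (mate i); rewrite sj => /(_ isT) bj.
rewrite pair_quotE // si mul1r in Ki; rewrite /= !pair_quotE // si sj mul1r.
rewrite pair_quotE // sj mulf_eq0 negb_or in Kj; case/andP: Kj => Aj Kj.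
split; last by rewrite mulf_neq0 // invr_eq0 mulf_neq0.
by field; rewrite Kj Aj Ki bj.
Qed.

Lemma node_of_coord a b i : spectral a b -> good_data a b -> node_of (coord_of a b) i = a i.
Proof.
move=> sp gw; rewrite /node_of; case: ifP => si; last first.
  by rewrite /coord_of si mulrA side_sqr mul1r addrC subrK.
have [-> tj0] := coord_secondary sp gw si.
have mi := secondary_mated si.
have mj : mate (mate i) != mate i by rewrite mateK eq_sym.
have sj : secondary (mate i) = false by rewrite secondary_mate // si.
have [E1 E2] := pair_data sp gw mi; have [_] := pair_data sp gw mj.
rewrite mateK root_at_mate => E3.
rewrite /coord_of sj mulrA side_sqr mul1r [lam (anchor _) + _]addrC subrK E3.
set ti := b i / _ in E1 E2 *; set tj := b (mate i) / _ in E1 E3 tj0 *.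
apply/eqP; rewrite subr_eq -subr_eq0; apply/eqP.
transitivity ((lam (root_at i) - a i) - ti * (a (mate i) - a i)); first by field.
by rewrite -[lam _ - _]opprB E2; ring.
Qed.

Lemma weight_of_coord a b i : spectral a b -> good_data a b ->
  b i = coord_of a b i * weight_factor (coord_of a b) i.
Proof.
move=> sp gw; rewrite /weight_factor (quot_ext _ (fun i => node_of_coord i sp gw)).
have [Qi Pi _ _] := gw i; have [mi|mi] := eqVneq (mate i) i.
  have si : secondary i = false by rewrite /secondary mi eqxx.
  rewrite /coord_of si /share mi eqxx mulr1.
  rewrite mulrACA side_sqr mul1r; have := spectral_node i sp.
  by rewrite prod_single // (root_single _ mi) => E; apply: (mulIf Qi); rewrite /quot;
    apply: oppr_inj; rewrite -mulNr -E; field.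
have mj : mate (mate i) != mate i by rewrite mateK eq_sym.
have [E1 _] := pair_data sp gw mi.
have Ki := pair_quot_neq0 gw mi; have Kj := pair_quot_neq0 gw mj.
rewrite /share (negPf mi); case: ifP => si.
  have [-> tj0] := coord_secondary sp gw si.
  rewrite /side si mul1r; have -> : quot a i = pair_quot a i by rewrite pair_quotE // si mul1r.
  set ti := b i / _ in E1 *; set tj := b (mate i) / _ in E1 tj0 *.
  have -> : 1 + ti / tj = tj^-1.
    by apply: (mulIf tj0); rewrite mulVf // mulrDl mul1r divfK // addrC.
  by rewrite invrK; transitivity (ti * pair_quot a i); [rewrite /ti divfK | field].
have sj : secondary (mate i) by rewrite secondary_mate // si.
have [-> tj0] := coord_secondary sp gw sj; rewrite mateK in tj0 *.
set ti := b i / _ in E1 tj0 *; set tj := b (mate i) / _ in E1 *.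
have -> : 1 + tj / ti = ti^-1.
  by apply: (mulIf tj0); rewrite mulVf // mulrDl mul1r divfK.
rewrite invrK /coord_of si.
have -> : side i * (a i - lam (anchor i)) * (side i * quot a i * ti) =
  (side i * side i) * ((a i - lam (anchor i)) * quot a i) * ti by ring.
have : pair_quot a i = (a i - lam (anchor i)) * quot a i by rewrite pair_quotE // si.
by move=> <-; rewrite side_sqr mul1r /ti mulrCA divff ?mulr1.
Qed.

Lemma good_data_base : good_data u w.
Proof.
move=> i; split.
- apply/prodf_neq0 => l /andP[li lm]; rewrite subr_eq0; apply: contraNneq li => e.
  by case: (mate_uniq (esym e)) lm => [->|->]; rewrite ?eqxx.
- apply/prodf_neq0 => m; apply: contraNneq => /eqP; rewrite subr_eq0 => /eqP e.
  have ke := root_atP (esym e); rewrite /factored /anchor ke eqxx.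
  by case: (mate i == i).
- move=> mi l; apply: contraNneq => e; apply/eqP.
  by rewrite (root_atP (esym e)).
- by move=> mi; rewrite /secondary mi /= negb_or => /andP[].
Qed.

(** At coincident nodes the common value of [pair_quot] is the sum of the two
    weights; this gives the signs at the base point. *)
Lemma pair_quot_base i : mate i != i -> pair_quot u i = w i + w (mate i).
Proof.
move=> mi; have [Q0 _ _ _] := good_data_base i.
have [||k ak E] := @spectral_double _ _ i (mate i) uw; rewrite 1?eq_sym ?mate_node //.
by rewrite /pair_quot /simple_roots (root_atP ak) E -/(gaps u i); field.
Qed.

Lemma good_coords_base : good_coords (coord_of u w).
Proof.
have gw := good_data_base; move=> i.
have Ea i' : node_of (coord_of u w) i' = u i' by exact: node_of_coord.
have KKE : quot (node_of (coord_of u w)) i = quot u i by apply: quot_ext.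
have QE : gaps (node_of (coord_of u w)) i = gaps u i.
  by rewrite /gaps Ea; apply: eq_bigr => l _; rewrite Ea.
have [Qi Pi _ _] := gw i.
have om_sec j : secondary j -> 1 + coord_of u w j != 0 /\ 0 < (1 + coord_of u w j)^-1.
  move=> sj; have mj := secondary_mated sj; have [-> tj0] := coord_secondary uw gw sj.
  have [E1 _] := pair_data uw gw mj.
  set ti := w j / _ in E1 *; set tj := w (mate j) / _ in E1 tj0 *.
  have -> : 1 + ti / tj = tj^-1.
    by apply: (mulIf tj0); rewrite mulVf // mulrDl mul1r divfK // addrC.
  rewrite invr_eq0 invrK; split=> //.
  rewrite lt_def tj0 /tj divr_ge0 // pair_quot_base ?mateK 1?eq_sym //.
  by rewrite addr_ge0.
split; rewrite ?QE //.
- rewrite /weight_factor KKE mulr_gt0 //.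
    rewrite /side; case: ifP => si.
      have mi := secondary_mated si; rewrite mul1r.
      by have := pair_quotE u mi; rewrite si mul1r => <-; rewrite pair_quot_base // mate_weight_gt0.
    case: ifP => [|/negbT]; first by rewrite mul1r.
    rewrite -leNgt mulN1r oppr_gt0 le_eqVlt => /orP[|//].
    by rewrite mulf_eq0 oppr_eq0 invr_eq0 (negPf Pi) (negPf Qi).
  rewrite /share; case: eqVneq => // mi; case: ifP => si; first by case: (om_sec _ si).
  have sj : secondary (mate i) by rewrite secondary_mate // si.
  by case: (om_sec _ sj).
- by move=> si; case: (om_sec _ si).
- move=> mi /negPf si; rewrite /coord_of si mulf_neq0 ?side_neq0 // subr_eq0.
  by rewrite -root_at_mated // (inj_eq lam_inj) eq_sym anchor_neq_root.
Qed.

End LocalModel.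
End Spectral.

(** * Continuity at a point *)
Section PointwiseContinuity.
Variables (K : numFieldType) (T : topologicalType).
Implicit Types (f g : T -> K) (x : T).

Lemma ctsD f g x : {for x, continuous f} -> {for x, continuous g} ->
  {for x, continuous (fun y => f y + g y)}.
Proof. by move=> cf cg; apply: cvgD. Qed.

Lemma ctsN f x : {for x, continuous f} -> {for x, continuous (fun y => - f y)}.
Proof. by move=> cf; apply: cvgN. Qed.

Lemma ctsB f g x : {for x, continuous f} -> {for x, continuous g} ->
  {for x, continuous (fun y => f y - g y)}.
Proof. by move=> cf cg; apply: cvgB. Qed.

Lemma ctsM f g x : {for x, continuous f} -> {for x, continuous g} ->
  {for x, continuous (fun y => f y * g y)}.
Proof. by move=> cf cg; apply: cvgM. Qed.

Lemma ctsV f x : f x != 0 -> {for x, continuous f} ->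
  {for x, continuous (fun y => (f y)^-1)}.
Proof. by move=> fx cf; apply: cvgV. Qed.

Lemma cts_cst (U : topologicalType) (c : U) x : {for x, continuous (fun _ : T => c)}.
Proof. exact: cvg_cst. Qed.

Lemma cts_prod (I : finType) (P : pred I) (F : I -> T -> K) x :
  (forall i, P i -> {for x, continuous (F i)}) ->
  {for x, continuous (fun y => \prod_(i | P i) F i y)}.
Proof. by move=> cF; apply: cvg_big => //; exact: mul_continuous. Qed.

Lemma cts_sum (I : finType) (P : pred I) (F : I -> T -> K) x :
  (forall i, P i -> {for x, continuous (F i)}) ->
  {for x, continuous (fun y => \sum_(i | P i) F i y)}.
Proof. by move=> cF; apply: cvg_big => //; exact: add_continuous. Qed.

Lemma cts_mx (U : topologicalType) m n (F : 'I_m -> 'I_n -> T -> U) x :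
  (forall i j, {for x, continuous (F i j)}) ->
  {for x, continuous (fun y => \matrix_(i, j) F i j y)}.
Proof.
move=> cF A [P MP PA].
suff : \forall y \near x, forall i j, P i j (F i j y).
  by apply: filterS => y Py; apply: PA => i j; rewrite mxE.
apply: filter_forall => i; apply: filter_forall => j.
by have := MP i j; rewrite mxE => /cF.
Qed.

Lemma cts_pair (U V : topologicalType) (f : T -> U) (g : T -> V) x :
  {for x, continuous f} -> {for x, continuous g} ->
  {for x, continuous (fun y => (f y, g y))}.
Proof. by move=> cf cg; apply: cvg_pair. Qed.

Lemma cts_comp (U V : topologicalType) (f : T -> U) (g : U -> V) x :
  {for x, continuous f} -> {for f x, continuous g} ->
  {for x, continuous (fun y => g (f y))}.
Proof. by move=> cf cg; apply: cvg_comp cf cg. Qed.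

Lemma near_neq0 f x : {for x, continuous f} -> f x != 0 ->
  \forall y \near x, f y != 0.
Proof. by move=> cf fx; apply: cvgr_neq0 cf fx. Qed.
End PointwiseContinuity.

Lemma near_gt0 (R : realFieldType) (T : topologicalType) (f : T -> R) x :
  {for x, continuous f} -> 0 < f x -> \forall y \near x, 0 < f y.
Proof. by move=> cf fx; apply: cvgr_gt cf _ fx. Qed.

Lemma near_impl (T : topologicalType) (P : Prop) (Q : T -> Prop) (x : T) :
  (P -> \forall y \near x, Q y) -> \forall y \near x, P -> Q y.
Proof.
by move=> H; have [p|np] := pselect P;
  [apply: filterS (H p) => y q _|apply: nearW => y /np].
Qed.

Lemma near_forall (T : topologicalType) (I : finType) (f : I -> T -> Prop) (x : T) :
  (forall i, \forall y \near x, f i y) -> \forall y \near x, forall i, f i y.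
Proof. by move=> H; apply: filter_forall. Qed.

(** * The local model as a homeomorphism *)
Section LocalModelTopology.
Variables (R : realType) (n : nat) (lam : 'I_n.+1 -> R).
Hypotheses (n_gt0 : (0 < n)%N) (lam_inj : injective lam).

(** Nodes and weights, as row vectors. *)
Definition data := ('rV[R]_n * 'rV[R]_n)%type.

Definition dataset : set data :=
  [set x : data | spectral lam (x.1 0) (x.2 0) /\ forall i, 0 <= x.2 0 i].

Lemma cts_coord m (r : 'rV[R]_m) i : {for r, continuous (fun s : 'rV[R]_m => s 0 i)}.
Proof. exact: coord_continuous. Qed.

Lemma cts_diag (x : data) i : {for x, continuous (fun y : data => y.1 0 i)}.
Proof.
by apply: (@cts_comp data 'rV[R]_n R fst (fun s : 'rV[R]_n => s 0 i));
  [exact: cvg_fst|exact: cts_coord].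
Qed.

Lemma cts_weight (x : data) i : {for x, continuous (fun y : data => y.2 0 i)}.
Proof.
by apply: (@cts_comp data 'rV[R]_n R snd (fun s : 'rV[R]_n => s 0 i));
  [exact: cvg_snd|exact: cts_coord].
Qed.

(** Near x0 the dataset is an orthant: psi parametrizes it by the nonnegative
    coordinates in V, with inverse rho, and the weights are the coordinates times a
    positive function T.  The last clause allows a node in W to be an eigenvalue only
    if it is the same one at x0; it will identify the eigenvalue at a node of weight
    zero. *)
Lemma local_model (x0 : data) : dataset x0 ->
  exists (psi : 'rV[R]_n -> data) (rho : data -> 'rV[R]_n)
    (T : 'rV[R]_n -> 'rV[R]_n) (V : set 'rV[R]_n) (W : set data),
  [/\ [/\ open V, open W & W x0],
      [/\ forall r, V r -> {for r, continuous psi},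
          forall r, V r -> {for r, continuous T},
          forall x, W x -> {for x, continuous rho} &
          forall x, W x -> V (rho x)],
      [/\ forall r i, V r -> 0 < T r 0 i,
          forall r i, V r -> (psi r).2 0 i = r 0 i * T r 0 i,
          forall r, V r -> (forall i, 0 <= r 0 i) -> dataset (psi r),
          forall r, V r -> rho (psi r) = r &
          forall x, W x -> dataset x -> psi (rho x) = x] &
      forall x i m, W x -> x.1 0 i = lam m -> x0.1 0 i = lam m].
Proof.
case=> sp w0; set u := x0.1 0 in sp; set w := x0.2 0 in sp w0.
pose al r := node_of lam u w r; pose TTT r := weight_factor lam u w r.
pose psi (r : 'rV[R]_n) : data :=
  (\row_i al (r 0) i, \row_i (r 0 i * TTT (r 0) i)).
pose ro (x : data) : 'rV[R]_n := \row_i coord_of lam u w (x.1 0) (x.2 0) i.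
pose T (r : 'rV[R]_n) : 'rV[R]_n := \row_i TTT (r 0) i.
pose V := [set r : 'rV[R]_n | good_coords lam u w (r 0)].
(* The last condition on W0, also open, is the last clause of the lemma. *)
pose W0 := [set x : data | [/\ good_data lam u w (x.1 0) (x.2 0), V (ro x) &
  forall i m, x0.1 0 i != lam m -> x.1 0 i != lam m]].
have psi1 r : (psi r).1 0 = al (r 0) by apply/funext => i; rewrite mxE.
have psi2 r : (psi r).2 0 = (fun i => r 0 i * TTT (r 0) i).
  by apply/funext => i; rewrite mxE.
have ro0 x : ro x 0 = coord_of lam u w (x.1 0) (x.2 0) by apply/funext => i; rewrite mxE.
have c_al r i : {for r, continuous (fun s : 'rV[R]_n => al (s 0) i)}.
  rewrite /al /node_of; case: (secondary u w i).
    apply: ctsB; first exact: cts_cst.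
    apply: ctsM; first exact: cts_coord.
    apply: ctsB; last exact: cts_cst.
    by apply: ctsD; [exact: cts_cst|apply: ctsM; [exact: cts_cst|exact: cts_coord]].
  by apply: ctsD; [exact: cts_cst|apply: ctsM; [exact: cts_cst|exact: cts_coord]].
have c_PP (S : topologicalType) (f : S -> R) s i : {for s, continuous f} ->
    {for s, continuous (fun s => kept_roots lam u w i (f s))}.
  by move=> cf; apply: cts_prod => m _; apply: ctsB => //; exact: cts_cst.
have c_QQ (S : topologicalType) (f : S -> 'I_n -> R) s i :
    (forall l, {for s, continuous (fun s => f s l)}) ->
    {for s, continuous (fun s => gaps u (f s) i)}.
  by move=> cf; apply: cts_prod => m _; apply: ctsB => //; exact: cf.
have c_KK (S : topologicalType) (f : S -> 'I_n -> R) s i :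
    (forall l, {for s, continuous (fun s => f s l)}) -> gaps u (f s) i != 0 ->
    {for s, continuous (fun s => quot lam u w (f s) i)}.
  move=> cf Q0; apply: ctsM; first by apply: ctsN; apply: c_PP.
  by apply: ctsV => //; apply: c_QQ.
have c_TT r i : V r -> {for r, continuous (fun s : 'rV[R]_n => TTT (s 0) i)}.
  move=> Vr; have [_ Q0 _ _] := Vr i.
  apply: ctsM.
    apply: ctsM; first exact: cts_cst.
    by apply: c_KK => // l; exact: c_al.
  rewrite /share; case mi: (mate u i == i); first exact: cts_cst.
  have c1 l : {for r, continuous (fun s : 'rV[R]_n => 1 + s 0 l)}.
    by apply: ctsD; [exact: cts_cst|exact: cts_coord].
  case si: (secondary u w i); apply: ctsV => //.
    by have [_ _ + _] := Vr i; apply.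
  by have [_ _ + _] := Vr (mate u i); apply; rewrite (secondary_mate lam_inj sp) ?mi ?si.
have oV : open V.
  rewrite openE => r Vr.
  suff : \forall s \near r, good_coords lam u w ((s : 'rV[R]_n) 0) by [].
  apply: (near_forall (f := fun i (s : 'rV[R]_n) => good_coords_at lam u w (s 0) i)) => i.
  have [T0 Q0 s0 p0] := Vr i.
  have n1 : \forall s \near r, 0 < weight_factor lam u w ((s : 'rV[R]_n) 0) i.
    by apply: near_gt0 => //; exact: c_TT.
  have n2 : \forall s \near r, gaps u (node_of lam u w ((s : 'rV[R]_n) 0)) i != 0.
    by apply: near_neq0 => //; apply: c_QQ => l; exact: c_al.
  have n3 : \forall s \near r, secondary u w i -> 1 + (s : 'rV[R]_n) 0 i != 0.
    apply: near_impl => /s0 h; apply: near_neq0 => //.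
    by apply: ctsD; [exact: cts_cst|exact: cts_coord].
  have n4 : \forall s \near r, mate u i != i -> ~~ secondary u w i -> (s : 'rV[R]_n) 0 i != 0.
    apply: near_impl => h1; apply: near_impl => h2.
    by apply: near_neq0; [exact: cts_coord|exact: p0].
  by near=> s; split; near: s.
have c_ro (x : data) : good_data lam u w (x.1 0) (x.2 0) -> {for x, continuous ro}.
  move=> gw; apply: cts_mx => _ i; rewrite /coord_of.
  case si: (secondary u w i).
    have mi := secondary_mated si; have mj : mate u (mate u i) != mate u i.
      by rewrite (mateK lam_inj sp) eq_sym.
    have sj : secondary u w (mate u i) = false by rewrite (secondary_mate lam_inj sp) ?si.
    have [Qi Pi _ _] := gw i; have [Qj _ _ /(_ mj)] := gw (mate u i).
    rewrite sj => /(_ isT) bj.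
    have cK l : {for x, continuous (fun y : data => quot lam u w (y.1 0) l)}.
      by have [Ql _ _ _] := gw l; apply: c_KK => // k; exact: cts_diag.
    apply: ctsM; last first.
      apply: ctsV; last by apply: ctsM; [exact: cts_weight|exact: cK].
      by rewrite mulf_neq0 // mulf_neq0 ?oppr_eq0 ?invr_eq0.
    apply: ctsM; first exact: cts_weight.
    apply: ctsM; first exact: cK.
    by apply: ctsB; [exact: cts_diag|exact: cts_cst].
  apply: ctsM; first exact: cts_cst.
  by apply: ctsB; [exact: cts_diag|exact: cts_cst].
have oW : open W0.
  rewrite openE => x [gw Vx lx].
  have n1 : \forall y \near x, V (ro y).
    by apply: (c_ro x gw); move: oV; rewrite openE => /(_ _ Vx).
  have n2 : \forall y \near x, good_data lam u w ((y : data).1 0) (y.2 0).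
    apply: (near_forall (f := fun i (y : data) =>
      good_data_at lam u w (y.1 0) (y.2 0) i)) => i; have [Q0 P0 l0 b0] := gw i.
    have m1 : \forall y \near x, gaps u ((y : data).1 0) i != 0.
      by apply: near_neq0 => //; apply: c_QQ => l; exact: cts_diag.
    have m2 : \forall y \near x, kept_roots lam u w i ((y : data).1 0 i) != 0.
      by apply: near_neq0 => //; apply: c_PP; exact: cts_diag.
    have m3 : \forall y \near x, mate u i != i -> forall l, l != root_at lam u i ->
        (y : data).1 0 i != lam l.
      apply: near_impl => h1; apply: (near_forall (f := fun l (y : data) =>
        l != root_at lam u i -> y.1 0 i != lam l)) => l; apply: near_impl => h2.
      have := l0 h1 l h2; rewrite -subr_eq0 => h3.
      have : \forall y \near x, (y : data).1 0 i - lam l != 0.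
        apply: near_neq0 => //.
        by apply: ctsB; [exact: cts_diag|exact: cts_cst].
      by apply: filterS => y; rewrite subr_eq0.
    have m4 : \forall y \near x, mate u i != i -> ~~ secondary u w i -> (y : data).2 0 i != 0.
      apply: near_impl => h1; apply: near_impl => h2.
      by apply: near_neq0; [exact: cts_weight|exact: b0].
    by near=> y; split; near: y.
  have n3 : \forall y \near x, forall i m, x0.1 0 i != lam m -> (y : data).1 0 i != lam m.
    apply: (near_forall (f := fun i (y : data) =>
      forall m, x0.1 0 i != lam m -> y.1 0 i != lam m)) => i.
    apply: (near_forall (f := fun m (y : data) =>
      x0.1 0 i != lam m -> y.1 0 i != lam m)) => m; apply: near_impl => h.
    have := lx i m h; rewrite -subr_eq0 => h3.
    have : \forall y \near x, (y : data).1 0 i - lam m != 0.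
      apply: near_neq0 => //.
      by apply: ctsB; [exact: cts_diag|exact: cts_cst].
    by apply: filterS => y; rewrite subr_eq0.
  have : \forall y \near x, W0 y by near=> y; split; near: y.
  by [].
exists psi, ro, T, V, W0; split.
- split=> //; split.
  + exact: good_data_base.
  + by rewrite /V /= ro0; exact: good_coords_base.
  + by [].
- split=> [r Vr|r Vr|x [gw _ _]|x []//].
  + apply: cts_pair; first by apply: cts_mx => _ i; exact: c_al.
    by apply: cts_mx => _ i; apply: ctsM; [exact: cts_coord|exact: c_TT].
  + by apply: cts_mx => _ i; exact: c_TT.
  + exact: c_ro.
- split=> [r i Vr|r i Vr|r Vr r0|r Vr|x [gw _ _] [sx _]].
  + by rewrite mxE; have [] := Vr i.
  + by rewrite !mxE.
  + split; first by rewrite psi1 psi2; exact: node_of_spectral.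
    by move=> i; rewrite mxE mulr_ge0 // ltW //; have [] := Vr i.
  + by apply/rowP => i; rewrite mxE psi1 psi2; exact: coord_of_node.
  + rewrite [RHS]surjective_pairing; congr (_, _); apply/rowP => i; rewrite !mxE ro0.
      exact: node_of_coord.
    by rewrite -weight_of_coord.
- by move=> x i m [_ _ lx] e; apply/eqP; apply: contraTT isT => /(lx i m); rewrite e eqxx.
Unshelve. all: by end_near. Qed.
End LocalModelTopology.

(** * Connectedness of dense subsets *)
Section Connectedness.
Variable T : topologicalType.
Implicit Types A B F O W : set T.

Lemma component_mono A B x y : A `<=` B ->
  connected_component A x y -> connected_component B x y.
Proof. by move=> AB [C [Cx CA Cc] Cy]; exists C => //; split=> // z /CA/AB. Qed.

Lemma all_joined_connected A x :
  (forall y, A y -> connected_component A x y) -> connected A.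
Proof.
move=> H; have -> : A = connected_component A x.
  by apply/seteqP; split=> //; exact: connected_component_sub.
exact: component_connected.
Qed.

(** A connected set F cannot be cut by a subset O which is dense in F and locally
    connected at all points of F.  For a clopen part B of O, every point of F has a
    neighbourhood meeting O either within B or outside B; by density these two open
    conditions exclude each other, so that one of them holds on all of F. *)
Lemma dense_connected F O : connected F -> O `<=` F -> F `<=` closure O ->
  (forall y, F y -> exists2 W, nbhs y W & connected (W `&` O)) -> connected O.
Proof.
move=> cF OF FO H B [b Bb] [C oC BC] [D cD BD].
pose G := \bigcup_(W in [set W : set T | W `&` O `<=` B]) W°.
pose G' := \bigcup_(W in [set W : set T | W `&` O `<=` ~` B]) W°.
have oG : open G by apply: bigcup_open => W _; exact: open_interior.
have oG' : open G' by apply: bigcup_open => W _; exact: open_interior.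
have BO : B `<=` O by rewrite BC => z [].
have cover y : F y -> G y \/ G' y.
  move=> Fy; have [W nW cW] := H y Fy.
  have [[z [Wz Bz]]|N] := pselect (exists z, W z /\ B z); last first.
    by right; exists W => // z [Wz _] Bz; apply: N; exists z.
  left; exists W => //= t [Wt Ot].
  have : W `&` O `&` B = W `&` O.
    apply: cW; first by exists z; split=> //; split=> //; exact: BO.
      exists C => //; rewrite BC; apply/seteqP; split=> s /=; tauto.
    exists D => //; rewrite BD; apply/seteqP; split=> s /=; tauto.
  by move/seteqP => [_ /(_ t)] [].
have disj y : F y -> G y -> G' y -> False.
  move=> Fy [W WB iW] [W' WB' iW'].
  have [z [Oz [Wz Wz']]] := FO y Fy _ (filterI iW iW').
  by apply: (WB' z) => //; exact: WB.
have FG : F `&` G = F.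
  apply: cF.
  - exists b; split; first exact/OF/BO.
    have [//|[W WB iW]] := cover b (OF _ (BO _ Bb)).
    by case: (WB b) => //; split; [exact: interior_subset|exact: BO].
  - by exists G.
  - exists (~` G'); first exact: open_closedC.
    apply/seteqP; split=> y [Fy Gy]; split=> //; first by move=> /(disj y Fy Gy).
    by have [|/Gy] := cover y Fy.
apply/seteqP; split=> // o Oo.
have : (F `&` G) o by rewrite FG; exact: OF.
by move=> [_ [W WB iW]]; apply: WB; split=> //; exact: interior_subset.
Qed.
End Connectedness.

Section PathsSegments.
Variables (R : realType) (T : topologicalType).

Lemma path_joined (A : set T) (g : R -> T) (c d : R) : c <= d ->
  (forall t, c <= t <= d -> {for t, continuous g}) ->
  (forall t, c <= t <= d -> A (g t)) -> connected_component A (g c) (g d).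
Proof.
move=> cd cg gA; exists (g @` `[c, d]); last first.
  by exists d => //=; rewrite in_itv /= cd lexx.
split.
- by exists c => //=; rewrite in_itv /= cd lexx.
- by move=> _ [t /= + <-]; rewrite in_itv /= => /gA.
- apply: connected_continuous_connected; first exact: segment_connected.
  apply: continuous_in_subspaceT => t; rewrite inE /= in_itv /=.
  exact: cg.
Qed.
End PathsSegments.

(** * Faces in local coordinates *)
Section DataFaces.
Variables (R : realType) (n : nat) (lam : 'I_n.+1 -> R).
Hypotheses (n_gt0 : (0 < n)%N) (lam_inj : injective lam).
Implicit Types (N : {set 'I_n}) (p q : {perm 'I_n.+1}) (x y : data R n).

Definition data_face N p : set (data R n) := [set x : data R n | dataset lam x /\
  forall i, i \notin N -> x.2 0 i = 0 /\ x.1 0 i = lam (p (lift ord0 i))].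

Definition data_stratum N p : set (data R n) := [set x : data R n | data_face N p x /\
  forall i, i \in N -> x.2 0 i != 0].

Lemma weight0_eigen x i : dataset lam x -> x.2 0 i = 0 -> exists m, x.1 0 i = lam m.
Proof.
move=> [sp _] w0; have := spectral_node i sp; rewrite w0 oppr0 mul0r.
by move=> /eqP/prodf_eq0[m _]; rewrite subr_eq0 => /eqP; exists m.
Qed.

Lemma convex_lt (a b c t : R) : a < c -> b < c -> 0 <= t <= 1 ->
  (1 - t) * a + t * b < c.
Proof. by move=> ac bc /andP[t0 t1]; case: (leP a b) => ab; nra. Qed.

Lemma segment_ball (m : nat) (r0 : 'rV[R]_m) d (r s : 'rV[R]_m) t :
  ball r0 d r -> ball r0 d s -> 0 <= t <= 1 -> ball r0 d ((1 - t) *: r + t *: s).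
Proof.
move=> [d0 br] [_ bs] t01; split=> // i j; rewrite !mxE.
have := br i j; have := bs i j; rewrite /ball /= !ltr_norml => /andP[a1 a2] /andP[a3 a4].
have := convex_lt a4 a2 t01.
have : (1 - t) * - (r0 i j - r i j) + t * - (r0 i j - s i j) < d.
  by apply: convex_lt; rewrite // ltrNl.
by move=> h1 h2; apply/andP; split; lra.
Qed.

(** In the coordinates of [local_model] the stratum near y is given by r_i = 0
    outside N and r_i > 0 on N, where nodes of weight zero keep their eigenvalues by
    rigidity.  In a ball this set is convex, which gives local connectedness, and adding a
    small multiple of the indicator of N moves any point of the face into it, which gives
    density. *)
Lemma local_faces N p y : data_face N p y ->
  closure (data_stratum N p) y /\ exists2 W, nbhs y W & connected (W `&` data_stratum N p).
Proof.
move=> [dy fy]; have [psi [rho [T [V [W [[oV oW Wy] [cpsi _ crho rhoV]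
  [Tpos psi2 psiX rhoK psiK] rigid]]]]]] := local_model n_gt0 lam_inj dy.
set r0 := rho y; have Vr0 : V r0 by exact: rhoV.
have psi0 : psi r0 = y by exact: psiK.
have r0T i : y.2 0 i = r0 0 i * T r0 0 i by rewrite -psi2 // psi0.
have r0_ge0 i : 0 <= r0 0 i.
  by have := dy.2 i; rewrite r0T pmulr_lge0 // Tpos.
have r0N i : i \notin N -> r0 0 i = 0.
  move=> /fy[+ _]; rewrite r0T => /eqP; rewrite mulf_eq0 => /orP[/eqP//|].
  by rewrite gt_eqF // Tpos.
have nW : \forall r \near r0, W (psi r).
  by apply: (cpsi r0 Vr0); rewrite psi0; move: oW; rewrite openE; apply.
have nV : \forall r \near r0, V r by move: oV; rewrite openE; apply.
(* The coordinates of the stratum in the ball of radius d around y. *)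
pose S d := [set r : 'rV[R]_n | [/\ ball r0 d r, forall i, i \notin N -> r 0 i = 0 &
  forall i, i \in N -> 0 < r 0 i]].
have S_O r d : V r -> W (psi r) -> S d r -> data_stratum N p (psi r).
  move=> Vr Wr [_ rN rP].
  have r_ge0 i : 0 <= r 0 i.
    by have [/rP/ltW|/rN->] := boolP (i \in N).
  have dx := psiX r Vr r_ge0.
  split; last first.
    by move=> i iN; rewrite psi2 // mulf_neq0 // gt_eqF // ?rP // Tpos.
  split=> // i iN; have w0 : (psi r).2 0 i = 0 by rewrite psi2 // rN // mul0r.
  split=> //; have [m e] := weight0_eigen dx w0.
  by rewrite e -(rigid _ i m Wr e); case: (fy i iN).
have Sshift d e : 0 < e -> e < d -> S d (r0 + e *: \row_i (i \in N)%:R).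
  move=> e0 ed; split.
  - split=> [|i j]; first exact: lt_trans ed.
    rewrite /ball /= !mxE ord1 opprD addrA subrr sub0r normrN.
    by case: (_ \in _); rewrite ?mulr1 ?mulr0 ?normr0 ?gtr0_norm //; exact: lt_trans ed.
  - by move=> i iN; rewrite !mxE r0N // (negPf iN) mulr0 addr0.
  - by move=> i iN; rewrite !mxE iN mulr1 ltr_wpDl.
split.
  move=> B nB.
  have nB' : \forall r \near r0, B (psi r).
    by apply: (cpsi r0 Vr0); rewrite psi0.
  have [d /= d0 bd] := (nbhs_ballP _ _).1 (filterI nB' (filterI nW nV)).
  have Sd : S d (r0 + (d / 2) *: \row_i (i \in N)%:R) by apply: Sshift; lra.
  have [b1 _ _] := Sd; have [Bx [Wx Vx]] := bd _ b1.
  by exists (psi (r0 + (d / 2) *: \row_i (i \in N)%:R)); split=> //; exact: S_O Sd.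
have [d /= d0 bd] := (nbhs_ballP _ _).1 (filterI nW nV).
exists (W `&` [set x | ball r0 d (rho x)]).
  apply: filterI; first by move: oW; rewrite openE; apply.
  by apply: (crho y Wy); apply: nbhsx_ballx.
have -> : W `&` [set x | ball r0 d (rho x)] `&` data_stratum N p = psi @` S d.
  apply/seteqP; split=> [x [[Wx bx] [[dx fx] ox]]|_ [r Sr <-]]; last first.
    have [br _ _] := Sr; have [Wr Vr] := bd _ br.
    by split; [split=> //=; rewrite rhoK|exact: S_O Sr].
  have xE := psiK x Wx dx; have Vx := rhoV x Wx.
  have xT i : x.2 0 i = rho x 0 i * T (rho x) 0 i by rewrite -psi2 // xE.
  exists (rho x) => //; split=> // i iN.
    have [+ _] := fx i iN; rewrite xT => /eqP; rewrite mulf_eq0 => /orP[/eqP//|].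
    by rewrite gt_eqF // Tpos.
  have := ox i iN; have := dx.2 i; rewrite xT pmulr_lge0 ?Tpos // => h1 h2.
  by rewrite lt_def h1 andbT; apply: contraNneq h2 => ->; rewrite mul0r.
apply: connected_continuous_connected; last first.
  apply: continuous_in_subspaceT => r; rewrite inE => -[br _ _].
  by apply: cpsi; have [] := bd _ br.
have d2 : S d (r0 + (d / 2) *: \row_i (i \in N)%:R) by apply: Sshift; lra.
set s0 := r0 + _ in d2; clearbody s0.
apply: (@all_joined_connected _ _ s0) => s Ss.
pose g (t : R) : 'rV[R]_n := (1 - t) *: s0 + t *: s.
have -> : s0 = g 0 by rewrite /g subr0 scale1r scale0r addr0.
have -> : s = g 1 by rewrite /g subrr scale0r scale1r add0r.
apply: path_joined => // t t01.
  apply: cvgD; apply: cvgZr_tmp; last exact: cvg_id.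
  by apply: cvgB; [exact: cvg_cst|exact: cvg_id].
have [b1 z1 p1] := d2; have [b2 z2 p2] := Ss.
split; first exact: segment_ball.
  by move=> i iN; rewrite !mxE z2 // z1 // !mulr0 addr0.
move=> i iN; have := p1 i iN; have := p2 i iN; rewrite !mxE => h1 h2.
by case/andP: t01 => t0 t1; nra.
Qed.

End DataFaces.

(** * Connectedness of the faces *)
Section FaceConnected.
Variables (R : realType) (n : nat) (lam : 'I_n.+1 -> R).
Hypotheses (n_gt0 : (0 < n)%N) (lam_inj : injective lam).
Implicit Types (N : {set 'I_n}) (p q : {perm 'I_n.+1}) (x y : data R n).
Local Notation X := (dataset lam).
Local Notation F := (data_face lam).
Local Notation O := (data_stratum lam).
Local Notation lf := (lift ord0).

(** Only the eigenvalues assigned to the columns outside N matter for a face. *)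
Definition agree_off N p q := forall i, i \notin N -> p (lf i) = q (lf i).

Lemma data_face_mono N N' p p' : N' \subset N -> agree_off N p' p -> F N' p' `<=` F N p.
Proof.
move=> NN pp x [dx fx]; split=> // i iN; rewrite -pp //; apply: fx.
by apply: contraNN iN; exact: (fintype.subsetP NN).
Qed.

(** The diagonal matrix with the eigenvalues arranged by p. *)
Definition vertex p : data R n := (\row_i lam (p (lf i)), 0).

Lemma prod_perm_split p (z : {poly R}) :
  \prod_m (z - (lam m)%:P) = (z - (lam (p ord0))%:P) * \prod_i (z - (lam (p (lf i)))%:P).
Proof. by rewrite (reindex_inj (@perm_inj _ p)) big_ord_recl. Qed.

Lemma sum_perm_split p : \sum_m lam m = lam (p ord0) + \sum_i lam (p (lf i)).
Proof. by rewrite (reindex_inj (@perm_inj _ p)) big_ord_recl. Qed.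

Lemma vertex_face N p : F N p (vertex p).
Proof.
split; last by move=> i _; rewrite !mxE.
split; last by move=> i; rewrite mxE.
rewrite /spectral /secular (prod_perm_split p) (sum_perm_split p) [\sum_i _%:P * _]big1 ?subr0.
  have -> : \sum_i (vertex p).1 0 i = \sum_i lam (p (lf i)).
    by apply: eq_bigr => i _; rewrite mxE.
  by rewrite addrK; congr (_ * _); apply: eq_bigr => i _; rewrite mxE.
by move=> i _; rewrite mxE polyC0 mul0r.
Qed.

Lemma face_vertex p x : F finset.set0 p x -> x = vertex p.
Proof.
move=> [_ fx]; rewrite [LHS]surjective_pairing; congr (_, _); apply/rowP => i;
  (have [|w a] := fx i; first by rewrite finset.in_set0); by rewrite !mxE ?w ?a.
Qed.

(** The node of weight zero is an eigenvalue lam_m.  No column outside N already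
    carries m, since two coincident nodes do not both have weight zero; so a transposition
    makes p assign m to the column j and leaves the columns outside N alone. *)
Lemma zero_weight_face N p x j : F N p x -> j \in N -> x.2 0 j = 0 ->
  exists2 p', F (N :\ j)%SET p' x & agree_off N p' p.
Proof.
move=> [dx fx] jN w0; have [m am] := weight0_eigen dx w0.
have ne l : l \notin N -> p (lf l) != m.
  move=> lN; apply/negP => /eqP e; have [wl al] := fx l lN.
  have jl : j != l by apply: contraNneq lN => <-.
  have [|+ _] := spectral_double_neq0 lam_inj dx.1 jl; first by rewrite al am e.
  by rewrite w0 wl addr0 eqxx.
pose p' := (p * tperm (p (lf j)) m)%g.
have p'off : agree_off N p' p.
  move=> l lN; rewrite permM tpermD //; last by rewrite eq_sym ne.
  by rewrite (inj_eq perm_inj) (inj_eq lift_inj); apply: contraNneq lN => <-.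
exists p' => //; split=> // l; rewrite in_setD1 negb_and negbK.
case: eqVneq => [->|lj] /=; first by rewrite permM tpermL.
by move=> lN; rewrite p'off //; exact: fx.
Qed.

(** The value at z of the product over the eigenvalues not assigned to columns
    outside N. *)
Definition rest_eval N p (z : R) := (z - lam (p ord0)) * \prod_(i in N) (z - lam (p (lf i))).

(** On a face the factors X - a_l of the columns l outside N divide both sides of
    the spectral equation; cancelling them leaves the equation of the arrow matrix on the
    columns in N. *)
Lemma reduced_node N p x i : spectral lam (x.1 0) (x.2 0) ->
    (forall l, l \notin N -> x.2 0 l = 0 /\ x.1 0 l = lam (p (lf l))) -> i \in N ->
  rest_eval N p (x.1 0 i) = - x.2 0 i * \prod_(l in N | l != i) (x.1 0 i - x.1 0 l).
Proof.
move=> sp fx iN; set a := x.1 0 in sp *; set b := x.2 0 in sp *.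
pose qZ := \prod_(l | l \notin N) ('X - (a l)%:P).
pose g := ('X - (lam (p ord0))%:P) * \prod_(l in N) ('X - (lam (p (lf l)))%:P).
pose a0 := \sum_m lam m - \sum_l a l.
pose s := ('X - a0%:P) * \prod_(l in N) ('X - (a l)%:P) -
  \sum_(l in N) (b l)%:P * \prod_(k in N | k != l) ('X - (a k)%:P).
have splitN (f : 'I_n -> {poly R}) (P : pred 'I_n) : \prod_(l | P l) f l =
    (\prod_(l | P l && (l \notin N)) f l) * \prod_(l | P l && (l \in N)) f l.
  by rewrite mulrC (bigID (fun l => l \in N)).
have gs : g = s.
  apply: (mulfI (prod_XsubC_neq0 (fun l => l \notin N) a)).
  rewrite -/qZ; move: sp; rewrite /spectral /secular -/a0 (prod_perm_split p).
  rewrite (splitN _ predT) /= (splitN (fun l => 'X - (a l)%:P) predT) /=.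
  have -> : \prod_(l | l \notin N) ('X - (lam (p (lf l)))%:P) = qZ.
    by apply: eq_bigr => l lN; rewrite /a (fx l lN).2.
  rewrite -/qZ mulrCA -/g => ->; rewrite /s mulrBr mulrCA; congr (_ - _).
  rewrite mulr_sumr (bigID (fun l => l \in N)) /= [X in _ + X]big1 ?addr0.
    apply: eq_bigr => l lN; rewrite (splitN _ (fun k => k != l)) mulrCA; congr (_ * (_ * _)).
      by apply: eq_bigl => k; case: eqVneq => [->|]; rewrite ?lN.
    by apply: eq_bigl => k; rewrite andbC.
  by move=> l lN; rewrite /b (fx l lN).1 polyC0 mul0r.
have -> : rest_eval N p (a i) = g.[a i].
  rewrite /g hornerM horner_prod hornerXsubC; congr (_ * _).
  by apply: eq_bigr => l _; rewrite hornerXsubC.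
rewrite gs /s hornerD hornerN hornerM horner_prod (bigD1 i) //= !hornerXsubC.
rewrite subrr mul0r mulr0 sub0r horner_sum (bigD1 i) //= [X in _ + X]big1 ?addr0.
  rewrite hornerM hornerC horner_prod mulNr; congr (- (_ * _)).
  by apply: eq_bigr => l _; rewrite hornerXsubC.
move=> l /andP[lN li]; rewrite hornerM horner_prod (bigD1 i) /=.
  by rewrite hornerXsubC subrr mul0r mulr0.
by rewrite iN eq_sym.
Qed.

(** The deformation of [secular_shift] applied to x. *)
Definition shift_node x i (t : R) : data R n :=
  let a := x.1 0 in let b := x.2 0 in
  let a0 := \sum_m lam m - \sum_l a l in
  (\row_l (if l == i then t else a l),
   \row_l (if l == i then
     (a0 + a i - t) * t - a0 * a i + b i - \sum_(l | l != i) b l * (t - a i) / (a l - t)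
     else b l * (a l - a i) / (a l - t))).

Lemma shift_node_spectral x i t : X x ->
    (forall l, l != i -> x.2 0 l != 0 -> x.1 0 l != t) ->
  spectral lam ((shift_node x i t).1 0) ((shift_node x i t).2 0).
Proof.
move=> [sp _] H; rewrite /spectral sp.
have -> : (shift_node x i t).1 0 = (fun l => if l == i then t else x.1 0 l).
  by apply/funext => l; rewrite mxE.
set a0 := \sum_m lam m - _.
rewrite -(secular_shift (t := t) a0 H).
have -> : \sum_m lam m - \sum_l (if l == i then t else x.1 0 l) = a0 + x.1 0 i - t.
  rewrite /a0 (bigD1 i) //= eqxx [\sum_l x.1 0 l](bigD1 i) //=.
  have -> : \sum_(l | l != i) (if l == i then t else x.1 0 l) = \sum_(l | l != i) x.1 0 l.
    by apply: eq_bigr => l /negPf->.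
  by ring.
by congr secular; apply/funext => l; rewrite mxE.
Qed.

Lemma shift_node_continuous x i t :
    (forall l, l != i -> x.2 0 l != 0 -> x.1 0 l != t) ->
  {for t, continuous (shift_node x i)}.
Proof.
move=> H; have cid (f : R -> R) : f = id -> {for t, continuous f} by move=> ->; exact: cvg_id.
have cq l (f : R -> R) : l != i -> {for t, continuous f} ->
    {for t, continuous (fun s => x.2 0 l * f s / (x.1 0 l - s))}.
  move=> li cf; have [e|ne] := eqVneq (x.2 0 l) 0.
    have -> : (fun s => x.2 0 l * f s / (x.1 0 l - s)) = (fun=> 0).
      by apply/funext => s; rewrite e !mul0r.
    exact: cts_cst.
  apply: ctsM; first by apply: ctsM => //; exact: cts_cst.
  apply: ctsV; first by rewrite subr_eq0 H.
  by apply: ctsB; [exact: cts_cst|exact: cid].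
apply: cts_pair; apply: cts_mx => _ l; case: (eqVneq l i) => li.
- exact: cid.
- exact: cts_cst.
- apply: ctsB; last first.
    apply: cts_sum => k ki; apply: cq => //.
    by apply: ctsB; [exact: cid|exact: cts_cst].
  apply: ctsD; last exact: cts_cst.
  apply: ctsB; last exact: cts_cst.
  apply: ctsM; last exact: cid.
  by apply: ctsB; [exact: cts_cst|exact: cid].
- by apply: cq => //; exact: cts_cst.
Qed.

Lemma shift_node_id x i : (forall l, l != i -> x.2 0 l != 0 -> x.1 0 l != x.1 0 i) ->
  shift_node x i (x.1 0 i) = x.
Proof.
move=> H; rewrite [RHS]surjective_pairing; congr (_, _); apply/rowP => l; rewrite !mxE.
  by case: eqVneq => [->|].
case: eqVneq => [->|li].
  rewrite [X in _ - X]big1 ?subr0; first by ring.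
  by move=> k _; rewrite subrr mulr0 mul0r.
have [->|bl] := eqVneq (x.2 0 l) 0; first by rewrite !mul0r.
by rewrite mulfK // subr_eq0 H.
Qed.

(** At a double node only the sum of the two weights enters the spectral
    equation, so that all the weight of j can be moved to i. *)
Lemma exchange_joined N p x i j : F N p x -> i \in N -> j \in N -> i != j ->
  x.1 0 i = x.1 0 j ->
  exists2 y, connected_component (F N p) x y & y.2 0 j = 0.
Proof.
move=> [[sp w0] fx] iN jN ij aij.
pose d (t : R) : 'rV[R]_n := \row_l (t * ((l == i)%:R - (l == j)%:R)).
pose g t : data R n := (x.1, x.2 + d t).
have gj : (g (x.2 0 j)).2 0 j = 0.
  by rewrite !mxE eqxx eq_sym (negPf ij) sub0r mulrN1 subrr.
exists (g (x.2 0 j)) => //.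
have x0 : x = g 0.
  rewrite [LHS]surjective_pairing /g; congr (_, _); apply/rowP => l.
  by rewrite !mxE mul0r addr0.
have -> : connected_component (F N p) x = connected_component (F N p) (g 0).
  by rewrite -x0.
apply: path_joined => // t /andP[t0 tj].
  apply: cts_pair; first exact: cts_cst.
  apply: cvgD; first exact: cvg_cst.
  apply: cts_mx => _ l; apply: ctsM; [exact: cvg_id|exact: cts_cst].
split; last first.
  move=> l lN; have [wl al] := fx l lN; split=> //; rewrite !mxE wl.
  have /negPf-> : l != i by apply: contraNneq lN => ->.
  have /negPf-> : l != j by apply: contraNneq lN => ->.
  by rewrite subrr mulr0 addr0.
split; last first.
  move=> l; rewrite !mxE; case: (eqVneq l i) => [->|_].
    by rewrite (negPf ij) subr0 mulr1 addr_ge0.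
  by case: eqVneq => [->|_]; rewrite ?subrr ?sub0r ?mulr0 ?addr0 // mulrN1 subr_ge0.
rewrite /spectral sp /secular /=; congr (_ - _).
have ji : j != i by rewrite eq_sym.
have PE : \prod_(l < n | l != j) ('X - (x.1 0 l)%:P) = \prod_(l < n | l != i) ('X - (x.1 0 l)%:P).
  rewrite (bigD1 i) //= [RHS](bigD1 j) //= aij; congr (_ * _).
  by apply: eq_bigl => l; rewrite andbC.
have splitS (b : 'I_n -> R) : \sum_l (b l)%:P * \prod_(k | k != l) ('X - (x.1 0 k)%:P) =
    (b i + b j)%:P * \prod_(k | k != i) ('X - (x.1 0 k)%:P) +
    \sum_(l | (l != i) && (l != j)) (b l)%:P * \prod_(k | k != l) ('X - (x.1 0 k)%:P).
  by rewrite (bigD1 i) //= [X in _ + X](bigD1 j) //= PE addrA polyCD mulrDl.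
rewrite !splitS; congr (_%:P * _ + _).
  by rewrite !mxE !eqxx (negPf ij) (negPf ji) /=; ring.
apply: eq_bigr => l /andP[/negPf li /negPf lj]; rewrite !mxE li lj.
by rewrite subrr mulr0 addr0.
Qed.

(** Lower the smallest node a_i along [shift_node] down to the largest remaining
    eigenvalue c below it.  There is one: otherwise g = rest_eval and
    H = prod_{l <> i} (X - a_l), l in N, would at a_i have signs making - b_i = g / H
    positive.  There is no remaining eigenvalue between c and a_i, and the other nodes are
    larger, so that all weights stay nonnegative; at c the weight b_i vanishes. *)
Lemma descent_joined N p x i : O N p x -> i \in N ->
    (forall l, l \in N -> l != i -> x.1 0 i < x.1 0 l) ->
  exists2 y, connected_component (F N p) x y & y.2 0 i = 0.
Proof.
move=> [Fx ox] iN amin; have [[sp w0] fx] := Fx.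
set ai := x.1 0 i in amin *.
pose H (t : R) := \prod_(l in N | l != i) (t - x.1 0 l).
have Hlt t l : t <= ai -> (l \in N) && (l != i) -> t - x.1 0 l < 0.
  by move=> ti /andP[lN li]; rewrite subr_lt0 (le_lt_trans ti) // amin.
have H0 t : t <= ai -> H t != 0.
  by move=> ti; apply/prodf_neq0 => l lP; rewrite lt_eqF // Hlt.
have bi : 0 < x.2 0 i by rewrite lt_def ox //= w0.
have gai : rest_eval N p ai = - x.2 0 i * H ai by exact: reduced_node.
have gai0 : rest_eval N p ai != 0.
  by rewrite gai mulf_neq0 ?oppr_eq0 ?ox // H0.
(* The indices j for which lam (p j) is a remaining eigenvalue. *)
pose blk := [pred j : 'I_n.+1 | if unlift ord0 j is Some l then l \in N else true].
have gE z : rest_eval N p z = \prod_(j | blk j) (z - lam (p j)).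
  rewrite /rest_eval big_mkcond [RHS]big_mkcond big_ord_recl /= unlift_none; congr (_ * _).
  by apply: eq_bigr => l _; rewrite liftK.
have lne j : blk j -> ai != lam (p j).
  move=> bj; apply: contraNneq gai0 => e; rewrite gE (bigD1 j) //= e subrr mul0r //.
have [j0 /andP[bj0 lj0]] : exists j, blk j && (lam (p j) < ai).
  apply/existsP; apply: contraT; rewrite negb_exists => /forallP no.
  have neg j : blk j -> ai - lam (p j) < 0.
    move=> bj; rewrite subr_lt0 lt_def eq_sym lne //=.
    by have := no j; rewrite bj /= -leNgt.
  have : 0 < rest_eval N p ai / H ai.
    rewrite /rest_eval (bigD1 i) //= mulrA -mulrA mulr_gt0 //.
      by rewrite nmulr_rgt0 ?neg //= ?unlift_none // liftK.
    rewrite /H -prodf_div; apply: prodr_gt0 => l lP.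
    rewrite nmulr_rgt0 ?invr_lt0 ?Hlt //.
    by apply: neg; rewrite /= liftK; case/andP: lP.
  by rewrite gai mulfK ?H0 // oppr_gt0 ltNge ltW.
pose P := [pred j | blk j && (lam (p j) < ai)].
have Pj0 : P j0 by apply/andP.
case: (@arg_maxP _ _ _ j0 P (fun j => lam (p j)) Pj0) => j /andP[bj lj] jmax.
set c := lam (p j) in lj jmax.
have off t : c <= t <= ai -> forall l, l != i -> x.2 0 l != 0 -> x.1 0 l != t.
  move=> /andP[_ ti] l li bl; rewrite gt_eqF // (le_lt_trans ti) // amin //.
  by apply: contraNT bl => /fx[-> _].
have Fshift t : c <= t <= ai -> spectral lam ((shift_node x i t).1 0) ((shift_node x i t).2 0) /\
   forall l, l \notin N -> (shift_node x i t).2 0 l = 0 /\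
     (shift_node x i t).1 0 l = lam (p (lf l)).
  move=> ct; split; first by apply: shift_node_spectral => //; exact: off.
  move=> l lN; have [wl al] := fx l lN; rewrite !mxE.
  have /negPf-> : l != i by apply: contraNneq lN => ->.
  by rewrite wl !mul0r.
(* From [reduced_node] at t and at ai, in a form which shows the sign. *)
have wi t : c <= t <= ai -> (shift_node x i t).2 0 i = x.2 0 i * (rest_eval N p t /
  rest_eval N p ai) * (H ai / H t).
  move=> ct; have [s1 s2] := Fshift t ct; have /andP[_ ti] := ct.
  have E : rest_eval N p t = - (shift_node x i t).2 0 i * H t.
    have sti : (shift_node x i t).1 0 i = t by rewrite mxE eqxx.
    have := reduced_node s1 s2 iN; rewrite sti => ->; congr (_ * _).
    by apply: eq_bigr => l /andP[_ /negPf li]; rewrite mxE li.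
  rewrite E gai; field.
  by rewrite ox // !H0.
have Fs t : c <= t <= ai -> F N p (shift_node x i t).
  move=> ct; have [s1 s2] := Fshift t ct; split=> //; split=> // l.
  have /andP[ct1 ti] := ct.
  have [->|li] := eqVneq l i.
    rewrite wi // mulr_ge0 //.
      rewrite mulr_ge0 //.
      rewrite !gE -prodf_div; apply: prodr_ge0 => k bk.
      have := lne k bk; rewrite neq_lt => /orP[kl|kl].
        rewrite nmulr_lge0 ?invr_lt0 ?subr_lt0 // subr_le0 (le_trans ti) //.
        exact: ltW.
      rewrite divr_ge0 ?subr_ge0 ?(ltW kl) // (le_trans _ ct1) //.
      by apply: jmax; apply/andP.
    rewrite /H -prodf_div; apply: prodr_ge0 => k kP.
    by rewrite ltW // nmulr_rgt0 ?invr_lt0 Hlt.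
  have [lN|lN] := boolP (l \in N); last by rewrite (s2 l lN).1.
  rewrite !mxE (negPf li) mulr_ge0 //; last first.
    by rewrite invr_ge0 subr_ge0 (le_trans ti) // ltW // amin.
  by rewrite mulr_ge0 // subr_ge0 ltW // amin.
have cai : c <= ai <= ai by rewrite lexx ltW.
have cc : c <= c <= ai by rewrite lexx ltW.
exists (shift_node x i c); last by rewrite wi // gE (bigD1 j) //= subrr !mul0r mulr0 mul0r.
apply: connected_component_sym; rewrite -{2}(shift_node_id (off _ cai)).
apply: path_joined => [|t ct|t ct]; [exact: ltW|exact: shift_node_continuous (off _ ct)|exact: Fs].
Qed.

(** Induction on the number of columns in N: each move makes a weight vanish, and
    [zero_weight_face] then passes to a face with one column less. *)
Lemma vertex_joined N p x : F N p x ->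
  exists2 q, agree_off N q p & connected_component (F N p) x (vertex q).
Proof.
have [k] := ubnP #|N|; elim: k N p x => // k IH N p x kN Fx.
have step y : F N p y -> forall j, j \in N -> y.2 0 j = 0 ->
    exists2 q, agree_off N q p & connected_component (F N p) y (vertex q).
  move=> Fy j jN wj; have [p' Fy' pp'] := zero_weight_face Fy jN wj.
  have [|q qp' cq] := IH (N :\ j)%SET p' y _ Fy'.
    by move: kN; rewrite (cardsD1 j N) jN.
  exists q; last first.
    by apply: component_mono cq; apply: data_face_mono pp'; exact: subsetDl.
  by move=> l lN; rewrite qp' ?pp' // in_setD1 negb_and lN orbT.
have [j /andP[jN /eqP wj]|nz] := pickP [pred j | (j \in N) && (x.2 0 j == 0)].
  exact: step Fx j jN wj.
have Ox : O N p x.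
  by split=> // i iN; have := nz i; rewrite /= iN => /negbT.
have [i0 i0N|N0] := pickP (mem N); last first.
  exists p => //; have N0' : N = finset.set0 by apply/finset.setP => l;
    rewrite finset.in_set0 -(N0 l).
  rewrite N0' in Fx *; rewrite -(face_vertex Fx); exact: connected_component_refl.
case: (@arg_minP _ _ _ i0 (mem N) (fun i => x.1 0 i) i0N) => i iN imin.
have [j /and3P[jN ji /eqP aji]|dis] := pickP [pred j | [&& j \in N, j != i & x.1 0 j == x.1 0 i]].
  have [|y cxy wy] := exchange_joined Fx iN jN _ (esym aji); first by rewrite eq_sym.
  have [q qp cyq] := step y (connected_component_sub cxy) j jN wy.
  by exists q => //; exact: connected_component_trans cyq.
have [|y cxy wy] := descent_joined Ox iN.
  move=> l lN li; rewrite lt_def imin // andbT.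
  by have := dis l; rewrite /= lN li /= => /negbT.
have [q qp cyq] := step y (connected_component_sub cxy) i iN wy.
by exists q => //; exact: connected_component_trans cyq.
Qed.

(** From a vertex only the node i moves, between the two eigenvalues lam (q i) = u
    and lam (q 0) = v, while the corner entry moves in the opposite direction; the weight
    b_i = - (t - u) (t - v) stays nonnegative. *)
Lemma edge_joined N p q i : agree_off N q p -> i \in N ->
  connected_component (F N p) (vertex q) (vertex (tperm ord0 (lf i) * q)%g).
Proof.
move=> qp iN; set q' := (_ * q)%g.
have FqX : X (vertex q) by have [] := vertex_face N q.
have off t l : l != i -> (vertex q).2 0 l != 0 -> (vertex q).1 0 l != t.
  by rewrite mxE eqxx.
pose g := shift_node (vertex q) i.
set u := lam (q (lf i)); set v := lam (q ord0).
have a0E : \sum_m lam m - \sum_l (vertex q).1 0 l = v.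
  have -> : \sum_l (vertex q).1 0 l = \sum_l lam (q (lf l)).
    by apply: eq_bigr => l _; rewrite mxE.
  by rewrite (sum_perm_split q) addrK.
have gi t : (g t).2 0 i = - ((t - u) * (t - v)).
  rewrite /g mxE eqxx a0E big1; last by move=> l _; rewrite mxE !mul0r.
  by rewrite !mxE -/u; ring.
have gl t l : l != i -> (g t).2 0 l = 0 by move=> li; rewrite /g !mxE (negPf li) !mul0r.
have Fg t : (t - u) * (t - v) <= 0 -> F N p (g t).
  move=> tuv; split; last first.
    move=> l lN; have li : l != i by apply: contraNneq lN => ->.
    by rewrite gl // /g !mxE (negPf li) qp.
  split; first by apply: shift_node_spectral => //; exact: off.
  by move=> l; have [->|li] := eqVneq l i; rewrite ?gi ?oppr_ge0 // gl.
have gu : g u = vertex q.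
  have := @shift_node_id (vertex q) i (off _); rewrite mxE; exact.
have gv : g v = vertex q'.
  rewrite [LHS]surjective_pairing; congr (_, _); apply/rowP => l; last first.
    rewrite [RHS]mxE; have [->|li] := eqVneq l i; last by rewrite gl.
    by rewrite gi subrr mulr0 oppr0.
  rewrite /g !mxE permM; case: eqVneq => [->|li]; first by rewrite tpermR.
  by rewrite tpermD ?neq_lift // (inj_eq lift_inj) eq_sym.
have cg t : {for t, continuous g} by apply: shift_node_continuous; exact: off.
rewrite -gu -gv; have [uv|/ltW vu] := leP u v.
  apply: path_joined => // t /andP[ut tv]; apply: Fg; nra.
apply: connected_component_sym.
by apply: path_joined => // t /andP[ut tv]; apply: Fg; nra.
Qed.

(** Transpositions with the corner index generate the permutations of the corner
    and N.  Two edges at most give one column l of N its final eigenvalue, and the rest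
    happens in the face where l is fixed. *)
Lemma vertices_joined N p q q' : agree_off N q p -> agree_off N q' p ->
  connected_component (F N p) (vertex q) (vertex q').
Proof.
have [k] := ubnP #|N|; elim: k N p q q' => // k IH N p q q' kN qp q'p.
have [l /= lN|N0] := pickP (mem N); last first.
  have -> : vertex q' = vertex q.
    congr (_, _); apply/rowP => i; rewrite !mxE qp ?q'p //; by have /= -> := N0 i.
  exact: connected_component_refl (data_face_mono (subxx _) qp (vertex_face _ _)).
have tp i q1 : i \in N -> agree_off N q1 p -> agree_off N (tperm ord0 (lf i) * q1)%g p.
  move=> iN q1p m mN; rewrite permM tpermD ?neq_lift ?q1p //.
  by rewrite (inj_eq lift_inj); apply: contraNneq mN => <-.
suff [q2 [q2p q2l c2]] : exists q2, [/\ agree_off N q2 p, q2 (lf l) = q' (lf l) &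
    connected_component (F N p) (vertex q) (vertex q2)].
  apply: connected_component_trans c2 _.
  apply: (@component_mono _ (F (N :\ l)%SET q')).
    by apply: data_face_mono => //; exact: subsetDl.
  apply: IH => //; first by move: kN; rewrite (cardsD1 l N) (lN : l \in N).
  move=> m; rewrite in_setD1 negb_and negbK; case: eqVneq => [->//|ml] /= mN.
  by rewrite q2p ?q'p.
(* The index at which q carries the eigenvalue wanted at l: if it is a column m,
   swap the corner with m first, and then with l. *)
pose j := (q^-1)%g (q' (lf l)).
have qj : q j = q' (lf l) by rewrite permKV.
have [jl|jl] := eqVneq j (lf l).
  exists q; split=> //; first by rewrite -qj jl.
  exact: connected_component_refl (data_face_mono (subxx _) qp (vertex_face _ _)).
case: (unliftP ord0 j) => [m|] jE; last first.
  exists (tperm ord0 (lf l) * q)%g; split; [exact: tp| |exact: edge_joined].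
  by rewrite permM tpermR -qj jE.
have mN : m \in N.
  apply: contraT => mN; have := qj; rewrite jE qp // -q'p // => /perm_inj/lift_inj ml.
  by rewrite ml lN in mN.
pose q1 := (tperm ord0 (lf m) * q)%g.
have q1p : agree_off N q1 p by exact: tp.
exists (tperm ord0 (lf l) * q1)%g; split; first exact: tp.
  by rewrite !permM tpermR tpermL -qj jE.
exact: connected_component_trans (edge_joined qp mN) (edge_joined q1p lN).
Qed.

Lemma data_face_connected N p : connected (F N p).
Proof.
apply: (@all_joined_connected _ _ (vertex p)) => x /vertex_joined[q qp cx].
apply: connected_component_trans (connected_component_sym cx).
exact: vertices_joined.
Qed.

Lemma data_face_closure N p : F N p `<=` closure (O N p).
Proof. by move=> y /(local_faces n_gt0 lam_inj)[]. Qed.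

Lemma data_stratum_connected N p : connected (O N p).
Proof.
apply: (@dense_connected _ (F N p)).
- exact: data_face_connected.
- by move=> x [].
- exact: data_face_closure.
- by move=> y /(local_faces n_gt0 lam_inj)[].
Qed.

Lemma data_stratum_nonempty N p : O N p !=set0.
Proof.
have [x [Ox _]] := data_face_closure (vertex_face N p) filterT.
by exists x.
Qed.

End FaceConnected.

(** * Real and complex numbers *)
Section ComplexNumbers.
Variable R : realType.
Local Notation C := (complexes R).
Implicit Types (x y : R) (z w : C).

(** The embedding of the reals with values in the packed type of complex
    numbers, where its morphism structures are found by inference. *)
Definition ofR x : C := real_complex R x.
Definition Re_ z : R := complex.Re z.
Definition modulus z : R := Re_ `|z|.

Lemma ofR_zmod : zmod_morphism ofR. Proof. by move=> x y; rewrite /ofR raddfB. Qed.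
Lemma ofR_monoid : monoid_morphism ofR.
Proof. by split=> [|x y]; rewrite /ofR ?rmorph1 ?rmorphM. Qed.
HB.instance Definition _ := GRing.isZmodMorphism.Build R C ofR ofR_zmod.
HB.instance Definition _ := GRing.isMonoidMorphism.Build R C ofR ofR_monoid.

Lemma ofRK : cancel ofR Re_. Proof. by []. Qed.
Lemma ofR_inj : injective ofR. Proof. exact: can_inj ofRK. Qed.

Lemma ofR_eq0 x : (ofR x == 0) = (x == 0).
Proof. by rewrite -(inj_eq ofR_inj) rmorph0. Qed.

Lemma ler_ofR x y : (ofR x <= ofR y) = (x <= y). Proof. exact: lecR. Qed.
Lemma ltr_ofR x y : (ofR x < ofR y) = (x < y). Proof. exact: ltcR. Qed.

Lemma Re_real z : z \is Num.real -> ofR (Re_ z) = z. Proof. exact: RRe_real. Qed.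

Lemma ofR_modulus z : ofR (modulus z) = `|z|. Proof. by rewrite Re_real ?normr_real. Qed.

Lemma modulus_ge0 z : 0 <= modulus z. Proof. by rewrite -ler_ofR rmorph0 ofR_modulus. Qed.

Lemma modulus_eq0 z : (modulus z == 0) = (z == 0).
Proof. by rewrite -ofR_eq0 ofR_modulus normr_eq0. Qed.

Lemma modulusM z w : modulus (z * w) = modulus z * modulus w.
Proof. by apply: ofR_inj; rewrite rmorphM !ofR_modulus normrM. Qed.

Lemma norm_ofR x : `|ofR x| = ofR `|x|.
Proof.
have [x0|x0] := leP 0 x; first by rewrite !ger0_norm // -(rmorph0 ofR) ler_ofR.
by rewrite !ltr0_norm ?rmorphN // -(rmorph0 ofR) ltr_ofR.
Qed.

Lemma modulus_ofR x : modulus (ofR x) = `|x|. Proof. by rewrite /modulus norm_ofR ofRK. Qed.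

Lemma modulus_sqr z : ofR (modulus z ^+ 2) = z * z^*.
Proof. by rewrite rmorphXn /= ofR_modulus normCK. Qed.

Lemma conj_ofR x : (ofR x)^* = ofR x.
Proof. by apply/CrealP; apply/complex_realP; exists x. Qed.

Lemma conj_real z : z^* = z -> ofR (Re_ z) = z.
Proof. by move=> /CrealP; exact: Re_real. Qed.

Lemma Re_sub z w : Re_ (z - w) = Re_ z - Re_ w. Proof. by case: z w => [? ?] [? ?]. Qed.

Lemma Re_norm z : ofR `|Re_ z| <= `|z|. Proof. exact: normc_ge_Re. Qed.

Lemma Re_continuous : continuous Re_.
Proof.
move=> z A /nbhs_ballP[e /= e0 eA]; apply/nbhs_ballP; exists (ofR e) => /=.
  by rewrite -(rmorph0 ofR) ltr_ofR.
move=> w zw; apply: eA; rewrite /ball /= -Re_sub -ltr_ofR.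
exact: le_lt_trans (Re_norm _) zw.
Qed.

Lemma ofR_continuous : continuous ofR.
Proof.
move=> x A /nbhs_ballP[e /= e0 eA]; apply/nbhs_ballP.
have eE : ofR (Re_ e) = e by rewrite Re_real // gtr0_real.
exists (Re_ e) => /=; first by rewrite -ltr_ofR eE rmorph0.
by move=> y xy; apply: eA; rewrite /ball /= -rmorphB norm_ofR -eE ltr_ofR.
Qed.

Lemma modulus_continuous : continuous modulus.
Proof.
move=> z; apply: (@cts_comp _ _ _ (fun w : C => `|w|) Re_); last exact: Re_continuous.
exact: norm_continuous.
Qed.
End ComplexNumbers.

(** * Arrow matrices with a given spectrum *)
Section Matrices.
Local Open Scope sesquilinear_scope.
Variables (R : realType) (n : nat) (lam : 'I_n.+1 -> R).
Hypothesis lam_inj : injective lam.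
Local Notation C := (complexes R).
Local Notation lf := (lift ord0).
Implicit Types (a : 'rV[R]_n) (b : 'rV[C]_n) (A B : 'M[C]_n.+1).

(** The arrow matrix of trace sum_m lam_m with further diagonal a and arms b. *)
Definition arrow a b : 'M[C]_n.+1 := \matrix_(i, j)
  match unlift ord0 i, unlift ord0 j with
  | None, None => ofR (\sum_m lam m - \sum_l a 0 l)
  | Some i', None => b 0 i'
  | None, Some j' => (b 0 j')^*
  | Some i', Some j' => ofR (a 0 i') *+ (i' == j')
  end.

Lemma arrow00 a b : arrow a b 0 0 = ofR (\sum_m lam m - \sum_l a 0 l).
Proof. by rewrite mxE unlift_none. Qed.
Lemma arrow_l0 a b i : arrow a b (lf i) 0 = b 0 i.
Proof. by rewrite mxE unlift_none liftK. Qed.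
Lemma arrow_0l a b i : arrow a b 0 (lf i) = (b 0 i)^*.
Proof. by rewrite mxE unlift_none liftK. Qed.
Lemma arrow_ll a b i j : arrow a b (lf i) (lf j) = ofR (a 0 i) *+ (i == j).
Proof. by rewrite mxE !liftK. Qed.

Lemma arrow_entriesP A B : A 0 0 = B 0 0 -> (forall i, A 0 (lf i) = B 0 (lf i)) ->
  (forall i, A (lf i) 0 = B (lf i) 0) ->
  (forall i j, A (lf i) (lf j) = B (lf i) (lf j)) -> A = B.
Proof.
move=> h1 h2 h3 h4; apply/matrixP => i j.
by case: (unliftP ord0 i) => [i'|] ->; case: (unliftP ord0 j) => [j'|] ->.
Qed.

Lemma adjE m p (A : 'M[C]_(m, p)) i j : (A^t* ) i j = (A j i)^*.
Proof. by rewrite !mxE. Qed.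

Lemma arrow_herm a b : arrow a b \is hermsymmx.
Proof.
apply/is_hermitianmxP; rewrite expr0 scale1r.
apply: arrow_entriesP => [|i|i|i j];
  rewrite adjE ?arrow00 ?arrow_l0 ?arrow_0l ?arrow_ll.
- by rewrite /= conj_ofR.
- by [].
- by rewrite /= conjCK.
- by rewrite /= rmorphMn /= conj_ofR eq_sym; case: eqVneq => [->|].
Qed.

Lemma arrow_arrow a b : arrow_matrix (arrow a b).
Proof.
move=> i j; case: (unliftP ord0 i) => [i'|] ->; last by rewrite eqxx.
case: (unliftP ord0 j) => [j'|] ->; last by rewrite eqxx.
by rewrite (inj_eq lift_inj) arrow_ll => /negPf->.
Qed.

Lemma map_secular (a0 : R) (a b : 'I_n -> R) :
  map_poly (@ofR R) (secular a0 a b) =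
  secular (ofR a0) (fun i => ofR (a i)) (fun i => ofR (b i)).
Proof.
rewrite /secular rmorphB rmorphM rmorph_prod rmorph_sum /=.
rewrite map_polyXsubC; congr (_ * _ - _).
  by apply: eq_bigr => i _; rewrite map_polyXsubC.
apply: eq_bigr => i _; rewrite rmorphM rmorph_prod /= map_polyC; congr (_ * _).
by apply: eq_bigr => l _; rewrite map_polyXsubC.
Qed.

(** The characteristic polynomial is real, which allows the spectral equation to
    be stated over the reals. *)
Lemma char_poly_herm A : A \is hermsymmx -> arrow_matrix A ->
  char_poly A = map_poly (@ofR R) (secular (Re_ (A 0 0))
    (fun i => Re_ (A (lf i) (lf i))) (fun i => modulus (A (lf i) 0) ^+ 2)).
Proof.
move=> /is_hermitianmxP; rewrite expr0 scale1r => hA arrA.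
have hE i j : A i j = (A j i)^* by rewrite {1}hA !mxE.
rewrite char_poly_arrow // map_secular; congr secular.
- by rewrite conj_real // -hE.
- by apply/funext => i; rewrite conj_real // -hE.
- by apply/funext => i; rewrite modulus_sqr (hE 0) mulrC.
Qed.

(** The n + 1 distinct eigenvalues are all the roots of the characteristic
    polynomial, so prescribing the set of eigenvalues prescribes the polynomial; its
    coefficient of degree n then yields the corner entry. *)
Lemma isospectral_arrowP A : isospectral_arrow lam A <->
  exists a b, spectral lam (a 0) (fun i => modulus (b 0 i) ^+ 2) /\ A = arrow a b.
Proof.
set P := \prod_m ('X - (lam m)%:P).
have rootP z : root (map_poly (@ofR R) P) z <-> exists i, z = ofR (lam i).
  have -> : map_poly (@ofR R) P = \prod_(x <- [seq ofR (lam m) | m <- enum 'I_n.+1]) ('X - x%:P).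
    rewrite big_map big_enum /= rmorph_prod /=.
    by apply: eq_bigr => m _; rewrite map_polyXsubC.
  rewrite root_prod_XsubC; split; first by case/mapP => i _ ->; exists i.
  by case=> i ->; apply: map_f; rewrite mem_enum.
split=> [[hA arrA eigA]|[a [b [sp ->]]]]; last first.
  split; [exact: arrow_herm|exact: arrow_arrow|move=> z].
  apply: (iff_trans _ (rootP z)); rewrite eigenvalue_root_char.
  rewrite char_poly_herm; [|exact: arrow_herm|exact: arrow_arrow].
  rewrite arrow00 ofRK.
  have -> : (fun i => Re_ (arrow a b (lf i) (lf i))) = a 0.
    by apply/funext => i; rewrite arrow_ll eqxx mulr1n ofRK.
  have -> : (fun i => modulus (arrow a b (lf i) 0) ^+ 2) = (fun i => modulus (b 0 i) ^+ 2).
    by apply/funext => i; rewrite arrow_l0.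
  by rewrite -sp.
pose a : 'rV[R]_n := \row_i Re_ (A (lf i) (lf i)).
pose b : 'rV[C]_n := \row_i A (lf i) 0.
have PE : map_poly (@ofR R) P = char_poly A.
  have := @all_roots_prod_XsubC _ (char_poly A) [seq ofR (lam m) | m <- enum 'I_n.+1].
  rewrite (monicP (char_poly_monic A)) scale1r size_char_poly size_map size_enum_ord.
  rewrite uniq_rootsE => -> //.
  - rewrite big_map big_enum /= rmorph_prod /=.
    by apply: eq_bigr => m _; rewrite map_polyXsubC.
  - apply/allP => _ /mapP[m _ ->]; rewrite -eigenvalue_root_char.
    by apply/eigA; exists m.
  - rewrite map_inj_uniq ?enum_uniq // => i j /ofR_inj; exact: lam_inj.
have aE : a 0 = (fun i => Re_ (A (lf i) (lf i))) by apply/funext => i; rewrite mxE.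
have bE : (fun i => modulus (b 0 i) ^+ 2) = (fun i => modulus (A (lf i) 0) ^+ 2).
  by apply/funext => i; rewrite mxE.
move: PE; rewrite char_poly_herm // => /(map_poly_inj (@ofR R)) PE.
have a0E : Re_ (A 0 0) = \sum_m lam m - \sum_l a 0 l.
  have [_ _ c1] := secular_coefs (Re_ (A 0 0)) (fun i => Re_ (A (lf i) (lf i)))
    (fun i => modulus (A (lf i) 0) ^+ 2).
  have pc : P`_n = - \sum_m lam m.
    have := @coefPn_prod_XsubC _ [seq lam m | m <- enum 'I_n.+1].
    by rewrite size_map size_enum_ord !big_map; exact.
  by move: c1; rewrite -PE pc aE => /oppr_inj ->; rewrite addrK.
exists a, b; split; first by rewrite /spectral -/P PE a0E aE bE.
move: (hA) => /is_hermitianmxP; rewrite expr0 scale1r => hE'.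
have hE i j : A i j = (A j i)^* by rewrite {1}hE' !mxE.
apply: arrow_entriesP => [|i|i|i j]; rewrite ?arrow00 ?arrow_l0 ?arrow_0l ?arrow_ll ?mxE //.
- by rewrite -a0E conj_real // -hE.
- by case: eqVneq => [->|ij]; [rewrite mulr1n conj_real // -hE|rewrite arrA // (inj_eq lift_inj)].
Qed.
End Matrices.

(** * The torus of diagonal unitary matrices *)
Section Torus.
Local Open Scope sesquilinear_scope.
Variables (R : realType).
Local Notation C := (complexes R).
Local Notation lf := (lift ord0).

Lemma conj_continuous : continuous (fun z : C => z^*).
Proof.
move=> z A /nbhs_ballP[e /= e0 eA]; apply/nbhs_ballP; exists e => //= w zw.
by apply: eA; rewrite /ball /= -rmorphB norm_conjC.
Qed.

Lemma torusP m (t : 'M[C]_m) : torus t <->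
  (forall i j, i != j -> t i j = 0) /\ forall i, t i i * (t i i)^* = 1.
Proof.
have prodE i j : (forall i j, i != j -> t i j = 0) ->
    (t *m t^t* ) i j = (t i i * (t i i)^* ) *+ (i == j).
  move=> d; rewrite mxE (bigD1 i) //= big1 ?addr0; last first.
    by move=> k ki; rewrite (d i k) ?mul0r // eq_sym.
  by rewrite adjE; case: eqVneq => [->//|ij]; rewrite (d j i) ?conjC0 ?mulr0 // eq_sym.
split=> [[/is_diag_mxP dt /unitarymxP ut]|[d u]].
  have d i j : i != j -> t i j = 0 by move=> ij; apply: dt.
  split=> // i; have := congr1 (fun A : 'M[C]_m => A i i) ut.
  by rewrite prodE // mxE eqxx.
split; first by apply/is_diag_mxP => i j ij; apply: d.
apply/unitarymxP/matrixP => i j; rewrite prodE // u mxE.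
by case: eqVneq.
Qed.

Lemma torus_eq m (t s : 'M[C]_m) : torus t -> torus s ->
  (forall i, t i i = s i i) -> t = s.
Proof.
move=> /torusP[dt _] /torusP[ds _] e; apply/matrixP => i j.
by have [->//|ij] := eqVneq i j; rewrite dt ?ds.
Qed.

Lemma torusM_diag m (t s : 'M[C]_m) i : torus t -> torus s ->
  (t *m s) i i = t i i * s i i.
Proof.
move=> /torusP[dt _] _; rewrite mxE (bigD1 i) //= big1 ?addr0 // => k ki.
by rewrite dt ?mul0r // eq_sym.
Qed.

Lemma torus_conjE m (t A : 'M[C]_m) i j : torus t ->
  (t *m A *m t^t* ) i j = t i i * A i j * (t j j)^*.
Proof.
move=> /torusP[d _]; rewrite mxE (bigD1 j) //= big1 ?addr0; last first.
  by move=> k kj; rewrite adjE d ?conjC0 ?mulr0 // eq_sym.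
rewrite adjE mxE (bigD1 i) //= big1 ?addr0 // => k ki.
by rewrite d ?mul0r // eq_sym.
Qed.

Lemma torus_nm m (t : 'M[C]_m) i : torus t -> modulus (t i i) = 1.
Proof.
move=> /torusP[_ u]; have : modulus (t i i) ^+ 2 = 1.
  by apply: ofR_inj; rewrite modulus_sqr u rmorph1.
by move=> /eqP; rewrite -[X in _ == X](expr1n _ 2) eqrXn2 ?modulus_ge0 ?ler01 // => /eqP.
Qed.

Lemma torus_diag m (d : 'rV[C]_m) : (forall i, d 0 i * (d 0 i)^* = 1) ->
  torus (diag_mx d).
Proof.
move=> u; apply/torusP; split=> [i j ij|i]; rewrite !mxE.
  by rewrite (negPf ij).
by rewrite eqxx !mulr1n.
Qed.

Lemma torus_scalar m (t : 'M[C]_m.+1) : torus t ->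
  is_scalar_mx t <-> forall i, t i i = t 0 0.
Proof.
move=> tt; split=> [/is_scalar_mxP[a ->] i|e]; first by rewrite !mxE !eqxx.
apply/is_scalar_mxP; exists (t 0 0); apply/matrixP => i j; rewrite mxE.
have /torusP[d _] := tt.
have [->|ij] := eqVneq i j; first exact: e.
exact: d.
Qed.

(** A diagonal unitary matrix modulo scalars is determined by the quotients of
    its entries by the corner entry, and these are the phases which act on the arms. *)
Definition std_iso n (t : 'M[C]_n.+1) : 'M[C]_n :=
  diag_mx (\row_i (t (lf i) (lf i) * (t 0 0)^* )).

Lemma std_iso_diag n (t : 'M[C]_n.+1) i :
  std_iso t i i = t (lf i) (lf i) * (t 0 0)^*.
Proof. by rewrite !mxE eqxx. Qed.

Lemma std_iso_torus n (t : 'M[C]_n.+1) : torus t -> torus (std_iso t).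
Proof.
move=> /torusP[_ u]; apply: torus_diag => i.
by rewrite mxE rmorphM /= conjCK mulrACA u [X in _ * X]mulrC u mulr1.
Qed.

Lemma std_iso_torus_iso n : torus_iso (@std_iso n).
Proof.
split.
- apply/seteqP; split=> [_ [t tt <-]|s ts]; first exact: std_iso_torus.
  (* Lift s with corner entry 1. *)
  pose t : 'M[C]_n.+1 := diag_mx (\row_j if unlift ord0 j is Some i then s i i else 1).
  have tt : torus t.
    apply: torus_diag => j; rewrite mxE; case: (unliftP ord0 j) => [i|] _.
      by have /torusP[_] := ts.
    by rewrite conjC1 mulr1.
  exists t => //; apply: torus_eq => // [|i]; first exact: std_iso_torus.
  rewrite std_iso_diag !mxE !eqxx !mulr1n liftK.
  have -> : unlift ord0 (0 : 'I_n.+1) = None by rewrite unlift_none.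
  by rewrite conjC1 mulr1.
- move=> t s tt ts; apply: torus_eq => [||i].
  + exact/std_iso_torus/torusM.
  + by apply: torusM; exact: std_iso_torus.
  rewrite torusM_diag; [|exact: std_iso_torus|exact: std_iso_torus].
  by rewrite !std_iso_diag !torusM_diag // rmorphM /=; ring.
- have -> : @std_iso n = (fun t => \matrix_(i, j) (t (lf i) (lf i) * (t 0 0)^* * (i == j)%:R)).
    by apply/funext => t; apply/matrixP => i j; rewrite !mxE mulr_natr.
  apply: continuous_subspaceT => t; apply: cts_mx => i j.
  apply: ctsM; last exact: cts_cst.
  apply: ctsM; first exact: coord_continuous.
  apply: (@cts_comp _ _ _ (fun y : 'M[C]_n.+1 => y 0 0) (fun z : C => z^*)).
    exact: coord_continuous.
  exact: conj_continuous.
- move=> t tt; have /torusP[_ u] := tt; rewrite (torus_scalar tt).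
  split=> [e i|e].
    case: (unliftP ord0 i) => [j|] -> //.
    have := congr1 (fun A : 'M[C]_n => A j j) e; rewrite std_iso_diag mxE eqxx.
    move=> /(congr1 (fun z => z * t 0 0)).
    by rewrite -mulrA [X in _ * X]mulrC u mulr1 mul1r.
  apply: torus_eq; [exact: std_iso_torus|exact: torus1|move=> i].
  by rewrite std_iso_diag e u mxE eqxx.
Qed.

End Torus.

(** * Orbits and equivariant charts *)
Section Manifold.
Local Open Scope sesquilinear_scope.
Variables (R : realType) (n : nat) (lam : 'I_n.+1 -> R).
Hypotheses (n_gt0 : (0 < n)%N) (lam_inj : injective lam).
Local Notation C := (complexes R).
Local Notation lf := (lift ord0).
Local Notation M := (arrow_manifold lam).
Implicit Types (A B : M).

Definition matrix_data A : data R n :=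
  (\row_i Re_ (\val A (lf i) (lf i)), \row_i (modulus (\val A (lf i) 0) ^+ 2)).

Definition arms A : 'rV[C]_n := \row_i \val A (lf i) 0.

Lemma matrix_data_arrow A a b : \val A = arrow lam a b ->
  [/\ (matrix_data A).1 = a, (matrix_data A).2 = \row_i (modulus (b 0 i) ^+ 2) & arms A = b].
Proof.
move=> AE; split; apply/rowP => i; rewrite !mxE AE ?arrow_l0 //.
by rewrite arrow_ll eqxx mulr1n ofRK.
Qed.

Lemma manifold_arrow A : \val A = arrow lam (matrix_data A).1 (arms A).
Proof.
have [a [b [_ AE]]] := (isospectral_arrowP lam_inj (\val A)).1 (set_mem (valP A)).
by have [-> _ ->] := matrix_data_arrow AE.
Qed.

Lemma matrix_data_dataset A : dataset lam (matrix_data A).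
Proof.
have [a [b [sp AE]]] := (isospectral_arrowP lam_inj (\val A)).1 (set_mem (valP A)).
have [d1 d2 _] := matrix_data_arrow AE; split; last first.
  by move=> i; rewrite mxE exprn_ge0 ?modulus_ge0.
rewrite d1 d2; suff -> : (\row_i (modulus (b 0 i) ^+ 2)) 0 = (fun i => modulus (b 0 i) ^+ 2) by [].
by apply/funext => i; rewrite mxE.
Qed.

Lemma arrow_in_manifold (a : 'rV[R]_n) (b : 'rV[C]_n) : spectral lam (a 0) (fun i =>
  modulus (b 0 i) ^+ 2) ->
  exists A, \val A = arrow lam a b.
Proof.
move=> sp; have H : isospectral_arrow lam (arrow lam a b).
  by apply/(isospectral_arrowP lam_inj); exists a, b.
by exists (SigSub (mem_set H)).
Qed.

Lemma manifold_eq A B : (matrix_data A).1 = (matrix_data B).1 -> arms A = arms B -> A = B.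
Proof. by move=> d c; apply: val_inj; rewrite !manifold_arrow d c. Qed.

Lemma entry_continuous i j : continuous (fun A => \val A i j).
Proof.
move=> A; apply: (@cts_comp M 'M[C]_n.+1 C (fun A => \val A) (fun X => X i j)).
  exact: initial_continuous.
exact: coord_continuous.
Qed.

Lemma matrix_data_continuous : continuous matrix_data.
Proof.
move=> A; apply: cts_pair; apply: cts_mx => _ i.
  apply: (@cts_comp M C R (fun A => \val A (lf i) (lf i)) (@Re_ R)).
    exact: entry_continuous.
  exact: Re_continuous.
have c : {for A, continuous (fun A : M => modulus (\val A (lf i) 0))}.
  apply: (@cts_comp M C R (fun A => \val A (lf i) 0) (@modulus R)).
    exact: entry_continuous.
  exact: modulus_continuous.
exact: ctsM.
Qed.

Lemma arrow_continuous (T : topologicalType) (f : T -> 'rV[R]_n) (g : T -> 'rV[C]_n) x :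
  {for x, continuous f} -> {for x, continuous g} ->
  {for x, continuous (fun y => arrow lam (f y) (g y))}.
Proof.
move=> cf cg.
have cfi i : {for x, continuous (fun y => f y 0 i)}.
  by apply: (@cts_comp _ _ _ f (fun r : 'rV[R]_n => r 0 i)) => //; exact: coord_continuous.
have cgi i : {for x, continuous (fun y => g y 0 i)}.
  by apply: (@cts_comp _ _ _ g (fun r : 'rV[C]_n => r 0 i)) => //; exact: coord_continuous.
apply: cts_mx => i j; case: (unlift ord0 i) => [i'|]; case: (unlift ord0 j) => [j'|].
- have -> : (fun y => ofR (f y 0 i') *+ (i' == j')) = (fun y => ofR (f y 0 i') * (i' == j')%:R).
    by apply/funext => y; rewrite mulr_natr.
  apply: ctsM; last exact: cts_cst.
  by apply: (@cts_comp _ _ _ (fun y => f y 0 i') (@ofR R)) => //; exact: ofR_continuous.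
- exact: cgi.
- apply: (@cts_comp _ _ _ (fun y => g y 0 j') (fun z : C => z^* )) => //.
  exact: conj_continuous.
- apply: (@cts_comp _ _ _ (fun y => \sum_m lam m - \sum_l f y 0 l) (@ofR R)).
    apply: ctsB; first exact: cts_cst.
    by apply: cts_sum => l _; exact: cfi.
  exact: ofR_continuous.
Qed.

(** The phases by which the arms of A and B differ, with phase 1 where the arms
    vanish, are the entries of a torus element carrying A to B. *)
Lemma same_orbitP A B : same_orbit A B <-> matrix_data A = matrix_data B.
Proof.
split=> [/asboolP[t tt AE]|].
  rewrite /matrix_data; congr (_, _); apply/rowP => i; rewrite !mxE AE torus_conjE //.
    by have /torusP[_ u] := tt; rewrite mulrAC u mul1r.
  by rewrite !modulusM (torus_nm _ tt) [modulus _^*]/modulus norm_conjC -/(modulus _)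
    (torus_nm _ tt) mulr1 mul1r.
move=> dE; have d1 := congr1 fst dE; have d2 := congr1 snd dE.
have nmE i : modulus (arms A 0 i) = modulus (arms B 0 i).
  have := congr1 (fun r : 'rV[R]_n => r 0 i) d2; rewrite !mxE => /eqP.
  by rewrite eqrXn2 ?modulus_ge0 // => /eqP.
pose ph i : C := if arms A 0 i == 0 then 1 else arms B 0 i / arms A 0 i.
have phE i : arms B 0 i = ph i * arms A 0 i.
  rewrite /ph; case: eqVneq => [e|ne]; last by rewrite divfK.
  by rewrite mul1r e; apply/eqP; rewrite -modulus_eq0 -nmE e modulus_eq0.
have ph1 i : ph i * (ph i)^* = 1.
  rewrite -modulus_sqr; suff -> : modulus (ph i) = 1 by rewrite expr1n rmorph1.
  rewrite /ph; case: eqVneq => [e|ne]; first by rewrite -(rmorph1 (@ofR R)) modulus_ofR normr1.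
  have na : modulus (arms A 0 i) != 0 by rewrite modulus_eq0.
  by apply: (mulIf na); rewrite -modulusM divfK // mul1r nmE.
pose t : 'M[C]_n.+1 := diag_mx (\row_j if unlift ord0 j is Some i then ph i else 1).
have t0 : t 0 0 = 1 by rewrite !mxE eqxx unlift_none.
have tl i : t (lf i) (lf i) = ph i by rewrite !mxE eqxx liftK.
have tt : torus t.
  apply: torus_diag => j; rewrite mxE; case: (unlift ord0 j) => [i|]; first exact: ph1.
  by rewrite conjC1 mulr1.
apply/asboolP; exists t => //.
apply: arrow_entriesP => [|i|i|i j]; rewrite torus_conjE // ?t0 ?tl !manifold_arrow d1
  ?arrow00 ?arrow_l0 ?arrow_0l ?arrow_ll ?conjC1 ?mul1r ?mulr1 //.
- by rewrite phE rmorphM /= mulrC.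
- case: eqVneq => [->|ij]; last by rewrite !mulr0n mulr0 mul0r.
  by rewrite !mulr1n mulrAC ph1 mul1r.
Qed.

Lemma sqrt_gt0_neq0 (x : R) : 0 < x -> ofR (Num.sqrt x) != 0.
Proof. by move=> x0; rewrite ofR_eq0 gt_eqF // sqrtr_gt0. Qed.

(** Take f_i = A_{i0} / sqrt T_i, with T from [local_model] at the data of A0.
    Then |f_i|^2 is the i-th coordinate of the local model, f is equivariant because T
    depends on the orbit only, and f is inverted by recovering the data from the |f_i|^2 and
    multiplying f_i by sqrt T_i. *)
Lemma chart_exists A0 : exists U f, [/\ locally_standard_chart U f, U A0 &
  forall A i, U A -> (f A 0 i == 0) = ((matrix_data A).2 0 i == 0)].
Proof.
have [psi [rho [T [V [W [[oV oW W0] [cpsi cT crho rhoV]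
  [Tpos psi2 psiX rhoK psiK] _]]]]]] := local_model n_gt0 lam_inj (matrix_data_dataset A0).
pose U : set M := matrix_data @^-1` W.
pose sT (r : 'rV[R]_n) i : C := ofR (Num.sqrt (T r 0 i)).
pose f A : 'rV[C]_n := \row_i (arms A 0 i / sT (rho (matrix_data A)) i).
have sT0 r i : V r -> sT r i != 0 by move=> Vr; apply: sqrt_gt0_neq0; exact: Tpos.
have nsT r i : V r -> modulus (sT r i) ^+ 2 = T r 0 i.
  move=> Vr; rewrite modulus_ofR ger0_norm ?sqrtr_ge0 // sqr_sqrtr // ltW //.
  exact: Tpos.
have c_sT r i : V r -> {for r, continuous (fun s => sT s i)}.
  move=> Vr; apply: (@cts_comp _ _ _ (fun s => Num.sqrt (T s 0 i)) (@ofR R)); last first.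
    exact: ofR_continuous.
  apply: (@cts_comp _ _ _ (fun s => T s 0 i) Num.sqrt); last exact: sqrt_continuous.
  apply: (@cts_comp _ _ _ T (fun s : 'rV[R]_n => s 0 i)); first exact: cT.
  exact: cts_coord.
have datE A i : U A -> (matrix_data A).2 0 i = rho (matrix_data A) 0 i * T (rho
  (matrix_data A)) 0 i.
  by move=> UA; rewrite -psi2 ?psiK //; [exact: matrix_data_dataset|exact: rhoV].
have fnm A i : U A -> modulus (f A 0 i) ^+ 2 = rho (matrix_data A) 0 i.
  move=> UA; have VA := rhoV _ UA; have T0 := Tpos _ i VA.
  have : modulus (f A 0 i) ^+ 2 * T (rho (matrix_data A)) 0 i = rho (matrix_data A) 0 i *
    T (rho (matrix_data A)) 0 i.
    rewrite -datE // -[in LHS](nsT _ i VA) -exprMn -modulusM !mxE divfK ?sT0 //.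
  by move=> /mulIf; apply; rewrite gt_eqF.
have oU : open U by apply: open_comp => // A _; exact: matrix_data_continuous.
exists U, f; split=> //; last first.
  move=> A i UA; have VA := rhoV _ UA.
  by rewrite -modulus_eq0 -sqrf_eq0 fnm // datE // mulf_eq0 [T _ _ _ == 0]gt_eqF ?orbF ?Tpos.
split.
- split=> // A B UA /same_orbitP dE; by rewrite /U /= -dE.
- apply: continuous_in_subspaceT => A; rewrite inE => UA; have VA := rhoV _ UA.
  apply: cts_mx => _ i; apply: ctsM.
    have -> : (fun y => arms y 0 i) = (fun y : M => \val y (lf i) 0).
      by apply/funext => y; rewrite mxE.
    exact: entry_continuous.
  apply: ctsV; first exact: sT0.
  apply: (@cts_comp _ _ _ (fun y => rho (matrix_data y)) (fun s => sT s i)); last exact: c_sT.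
  by apply: (@cts_comp _ _ _ matrix_data rho); [exact: matrix_data_continuous|exact: crho].
- move=> A B /set_mem UA /set_mem UB fE.
  have rE : rho (matrix_data A) = rho (matrix_data B) by apply/rowP => i; rewrite -!fnm // fE.
  have dE : matrix_data A = matrix_data B.
    by rewrite -(psiK _ UA (matrix_data_dataset A)) rE psiK //; exact: matrix_data_dataset.
  apply: manifold_eq; first by rewrite dE.
  apply/rowP => i; have := congr1 (fun r : 'rV[C]_n => r 0 i) fE; rewrite !mxE dE.
  have sB : (sT (rho (matrix_data B)) i)^-1 != 0 by rewrite invr_eq0 sT0 //; exact: rhoV.
  by move=> /(mulIf sB).
- move=> W1 oW1 W1U; rewrite openE => v [A W1A fA].
  have UA := W1U A W1A; have VA := rhoV _ UA.
  (* Near f A, the matrices g w built from w are defined and continuous in w, and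
     belong to W1, so that f has a neighbourhood of f A in its image. *)
  have [O' oO' O'E] := oW1.
  pose sq (v : 'rV[C]_n) : 'rV[R]_n := \row_i (modulus (v 0 i) ^+ 2).
  pose g (v : 'rV[C]_n) : 'M[C]_n.+1 :=
    arrow lam (psi (sq v)).1 (\row_i (v 0 i * sT (sq v) i)).
  have sqv : sq v = rho (matrix_data A) by apply/rowP => i; rewrite mxE -fA fnm.
  have c_sq w : {for w, continuous sq}.
    apply: cts_mx => _ i; have c : {for w, continuous (fun w : 'rV[C]_n => modulus (w 0 i))}.
      apply: (@cts_comp _ _ _ (fun w : 'rV[C]_n => w 0 i) (@modulus R)).
        exact: coord_continuous.
      exact: modulus_continuous.
    exact: ctsM.
  have gv : g v = \val A.
    rewrite /g sqv psiK //; last exact: matrix_data_dataset.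
    rewrite [RHS]manifold_arrow; congr arrow; apply/rowP => i.
    by rewrite [LHS]mxE -fA mxE divfK // sT0.
  have cg : {for v, continuous g}.
    apply: arrow_continuous.
      apply: (@cts_comp _ _ _ (fun w => psi (sq w)) fst); last exact: cvg_fst.
      by apply: (@cts_comp _ _ _ sq psi); [exact: c_sq|apply: cpsi; rewrite sqv].
    apply: cts_mx => _ i; apply: ctsM; first exact: coord_continuous.
    by apply: (@cts_comp _ _ _ sq (fun s => sT s i)); [exact: c_sq|apply: c_sT; rewrite sqv].
  have n1 : \forall w \near v, O' (g w).
    apply: cg; rewrite gv; apply: open_nbhs_nbhs; split=> //.
    by move: W1A; rewrite -O'E.
  have n2 : \forall w \near v, V (sq w).
    by apply: (c_sq v); rewrite sqv; apply: open_nbhs_nbhs.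
  have : \forall w \near v, (f @` W1) w; last by [].
  near=> w; have Ow : O' (g w) by near: w. have Vw : V (sq w) by near: w.
  have sqw0 i : 0 <= sq w 0 i by rewrite mxE exprn_ge0 // modulus_ge0.
  have psw i : modulus ((\row_i (w 0 i * sT (sq w) i)) 0 i) ^+ 2 = (psi (sq w)).2 0 i.
    by rewrite mxE modulusM exprMn nsT // psi2 // [sq w 0 i]mxE.
  have [B BE] : exists B, \val B = g w.
    apply: arrow_in_manifold; have [+ _] := psiX _ Vw sqw0.
    by congr spectral; apply/funext => i; rewrite psw.
  have W1B : W1 B by rewrite -O'E /= set_valE BE.
  exists B => //; have [d1 d2 c0] := matrix_data_arrow BE.
  have dB : matrix_data B = psi (sq w).
    rewrite [LHS]surjective_pairing [RHS]surjective_pairing d1 d2; congr (_, _).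
    by apply/rowP => i; rewrite mxE psw.
  by apply/rowP => i; rewrite mxE dB rhoK // c0 mxE mulfK // sT0.
- exists (@std_iso R n); first exact: std_iso_torus_iso.
  move=> t A B tt UA BE.
  have dE : matrix_data A = matrix_data B.
    by apply/same_orbitP/asboolP; exists t.
  apply/rowP => i; rewrite mul_mx_diag !mxE -dE BE torus_conjE //.
  by rewrite !mulrA; ring.
Unshelve. all: by end_near. Qed.
End Manifold.

(** * The number of vanishing coordinates in a chart *)
Section Depth.
Local Open Scope sesquilinear_scope.
Variables (R : realType).
Local Notation C := (complexes R).
Local Notation lf := (lift ord0).

(** The involutions of the torus are the diagonal sign matrices. *)
Definition sgn_mx m (B : {set 'I_m}) : 'M[C]_m := diag_mx (\row_i (-1) ^+ (i \in B)).

Lemma sgn_mx_diag m (B : {set 'I_m}) i : sgn_mx B i i = (-1) ^+ (i \in B).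
Proof. by rewrite !mxE eqxx. Qed.

Lemma sgn_mx_torus m (B : {set 'I_m}) : torus (sgn_mx B).
Proof.
apply: torus_diag => i; rewrite mxE; case: (i \in B); last by rewrite conjC1 mulr1.
by rewrite expr1 rmorphN /= conjC1 mulrNN mulr1.
Qed.

Lemma Nneq1 : (-1 : C) != 1.
Proof. by rewrite -subr_eq0 -opprD oppr_eq0 -[1 + 1]/(2%:R) pnatr_eq0. Qed.

Lemma sgn_inj (b c : bool) : (-1 : C) ^+ b = (-1) ^+ c -> b = c.
Proof.
have := Nneq1; case: b; case: c => //; rewrite expr0 expr1 => /eqP H e; first by case: H.
by case: H; rewrite -e.
Qed.

Lemma torus_involution m (t : 'M[C]_m) : torus t -> t *m t = 1%:M ->
  t = sgn_mx [set i | t i i == -1]%SET.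
Proof.
move=> tt t2; apply: torus_eq => // [|i]; first exact: sgn_mx_torus.
rewrite sgn_mx_diag inE; have := congr1 (fun A : 'M[C]_m => A i i) t2.
rewrite torusM_diag // mxE eqxx => /eqP; rewrite -expr2 sqrf_eq1 => /orP[] /eqP ->.
  by rewrite eq_sym (negPf Nneq1).
by rewrite eqxx.
Qed.

Variables (n : nat) (lam : 'I_n.+1 -> R).
Hypotheses (n_gt0 : (0 < n)%N) (lam_inj : injective lam).
Local Notation M := (arrow_manifold lam).

Lemma torus_conj_arrow t a b : torus t -> t *m arrow lam a b *m t^t* =
  arrow lam a (\row_i (t (lf i) (lf i) * b 0 i * (t 0 0)^* )).
Proof.
move=> tt; have /torusP[_ u] := tt.
apply: arrow_entriesP => [|i|i|i j]; rewrite torus_conjE //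
  ?arrow00 ?arrow_l0 ?arrow_0l ?arrow_ll ?mxE.
- by rewrite mulrAC u mul1r.
- by rewrite !rmorphM /= conjCK; ring.
- by [].
- case: eqVneq => [->|_]; first by rewrite mulr1n mulrAC u mul1r.
  by rewrite !mulr0n mulr0 mul0r.
Qed.

Section ChartDepth.
Variables (U : set M) (f : M -> 'rV[C]_n) (A : M).
Hypotheses (chart : locally_standard_chart U f) (UA : U A).

Let Z : {set 'I_n} := [set i | (matrix_data A).2 0 i == 0]%SET.
Let Z' : {set 'I_n} := [set i | f A 0 i == 0]%SET.

Lemma in_Z i : (i \in Z) = (arms A 0 i == 0).
Proof. by rewrite inE !mxE sqrf_eq0 modulus_eq0. Qed.

Lemma lift_sgn (B : {set 'I_n}) : exists2 t : 'M[C]_n.+1, torus t &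
  t 0 0 = 1 /\ forall i, t (lf i) (lf i) = (-1) ^+ (i \in B).
Proof.
exists (sgn_mx (lf @: B)%SET); first exact: sgn_mx_torus.
rewrite sgn_mx_diag; split=> [|i]; last by rewrite sgn_mx_diag (mem_imset _ _ lift_inj).
by case: imsetP => // -[i _ /eqP]; rewrite (negPf (neq_lift _ _)).
Qed.

(** For a set B of vanishing arms, the sign matrix changing the signs of the arms
    in B fixes A.  Its image in T^n is an involution fixing f A, hence changes signs only of
    vanishing coordinates of f A.  This is an injection of the subsets of Z into those of
    Z'. *)
Lemma card_zeros_le : (#|Z| <= #|Z'|)%N.
Proof.
have [[oU invU] cf injf openf [psi [psiT psiM psiC psiK] equiv]] := chart.
pose P (B : {set 'I_n}) (t : 'M[C]_n.+1) :=
  [/\ torus t, t 0 0 = 1 & forall i, t (lf i) (lf i) = (-1) ^+ (i \in B)].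
have /boolp.choice[T TP] : forall B, exists t, P B t.
  by move=> B; have [t tt [t0 tl]] := lift_sgn B; exists t.
have Tsq B : T B *m T B = 1%:M.
  have [tt t0 tl] := TP B; apply: torus_eq; [exact: torusM|exact: torus1|move=> i].
  rewrite torusM_diag // mxE eqxx; case: (unliftP ord0 i) => [j|] ->.
    by rewrite tl -expr2 sqrr_sign.
  by rewrite t0 mulr1.
have psi_torus t : torus t -> torus (psi t) by move=> tt; rewrite -psiT; exists t.
have psi1 : psi 1%:M = 1%:M.
  by apply/psiK; [exact: torus1|exact: scalar_mx_is_scalar].
have psiTsq B : psi (T B) *m psi (T B) = 1%:M.
  by have [tt _ _] := TP B; rewrite -psiM // Tsq.
pose phi (B : {set 'I_n}) : {set 'I_n} := [set i | psi (T B) i i == -1]%SET.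
have phiE B : psi (T B) = sgn_mx (phi B).
  by have [tt _ _] := TP B; apply: torus_involution; [exact: psi_torus|exact: psiTsq].
rewrite -(leq_exp2l #|Z| #|Z'| (ltnSn 1)) -!card_powerset.
have injphi : {in powerset Z &, injective phi}.
  move=> B D _ _ e; have [tB tB0 tBl] := TP B; have [tD tD0 tDl] := TP D.
  have : psi (T B *m T D) = 1%:M by rewrite psiM // !phiE e -phiE psiTsq.
  move/psiK => /(_ (torusM tB tD))/(torus_scalar (torusM tB tD)) sc.
  apply/finset.setP => i; apply: sgn_inj; have := sc (lf i).
  rewrite !torusM_diag // tBl tDl tB0 tD0 mulr1.
  by case: (i \in B); case: (i \in D) => //; rewrite ?mulr1 ?mul1r expr0 expr1.
rewrite -(card_in_imset injphi); apply/subset_leq_card/fintype.subsetP => _ /imsetP[B BZ ->].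
rewrite powersetE; apply/fintype.subsetP => i iB; rewrite inE.
have [tB tB0 tBl] := TP B.
have AE : \val A = T B *m \val A *m (T B)^t*.
  rewrite manifold_arrow // torus_conj_arrow //; congr arrow; apply/rowP => j.
  rewrite [RHS]mxE tBl tB0 conjC1 mulr1; case: (boolP (j \in B)) => jB; last by rewrite mul1r.
  have : j \in Z by move: BZ; rewrite powersetE => /fintype.subsetP; apply.
  by rewrite in_Z => /eqP->; rewrite mulr0.
have := congr1 (fun r : 'rV[C]_n => r 0 i) (equiv _ A A tB UA AE).
rewrite phiE mul_mx_diag !mxE iB mulrN1 => /eqP; rewrite -subr_eq0 opprK.
by rewrite -mulr2n mulrn_eq0.
Qed.

(** The same argument backwards: a sign matrix supported on vanishing coordinates
    of f A is the image of some t, normalized to t_00 = 1, which is again an involution and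
    fixes A since f is injective on U. *)
Lemma card_zeros_ge : (#|Z'| <= #|Z|)%N.
Proof.
have [[oU invU] cf injf openf [psi [psiT psiM psiC psiK] equiv]] := chart.
have psi1 : psi 1%:M = 1%:M.
  by apply/psiK; [exact: torus1|exact: scalar_mx_is_scalar].
have /boolp.choice[chi chiP] : forall B' : {set 'I_n}, exists B : {set 'I_n},
    B' \in powerset Z' -> B \in powerset Z /\ exists t, [/\ torus t, t 0 0 = 1,
      forall i, t (lf i) (lf i) = (-1) ^+ (i \in B) & psi t = sgn_mx B'].
  move=> B'; have [B'Z|_] := boolP (B' \in powerset Z'); last by exists B'.
  have : torus (sgn_mx B') by exact: sgn_mx_torus.
  rewrite -psiT => -[t0 tt0 pt0].
  have /torusP[_ u0] := tt0.
  have tc : torus ((t0 0 0)^*%:M : 'M[C]_n.+1).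
    rewrite -diag_const_mx; apply: torus_diag => i.
    by rewrite mxE conjCK mulrC u0.
  pose t := t0 *m (t0 0 0)^*%:M.
  have tt : torus t by exact: torusM.
  have t00 : t 0 0 = 1 by rewrite torusM_diag // mxE eqxx mulr1n u0.
  have pt : psi t = sgn_mx B'.
    rewrite psiM // pt0; have -> : psi ((t0 0 0)^*%:M) = 1%:M.
      by apply/psiK => //; exact: scalar_mx_is_scalar.
    by rewrite mulmx1.
  clearbody t; have sq1 : sgn_mx B' *m sgn_mx B' = 1%:M.
    apply: torus_eq; [by apply: torusM; exact: sgn_mx_torus|exact: torus1|move=> i].
    rewrite torusM_diag ?sgn_mx_diag; [|exact: sgn_mx_torus|exact: sgn_mx_torus].
    by rewrite -expr2 sqrr_sign mxE eqxx.
  have t2 : t *m t = 1%:M.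
    have /psiK : psi (t *m t) = 1%:M by rewrite psiM // pt.
    move=> /(_ (torusM tt tt))/(torus_scalar (torusM tt tt)) sc.
    apply: torus_eq; [exact: torusM|exact: torus1|move=> i].
    by rewrite sc torusM_diag // t00 mulr1 mxE eqxx.
  have tS := torus_involution tt t2.
  exists [set i | t (lf i) (lf i) == -1]%SET => _; split; last first.
    exists t; split=> // i; rewrite [in LHS]tS sgn_mx_diag.
    by congr (_ ^+ nat_of_bool _); rewrite !inE.
  rewrite powersetE; apply/fintype.subsetP => i; rewrite inE in_Z => /eqP ti.
  have AE := manifold_arrow lam_inj A.
  have [A2 A2E] : exists A2 : M, \val A2 = t *m \val A *m t^t*.
    rewrite {1}AE torus_conj_arrow //; apply: arrow_in_manifold => //.
    have [+ _] := matrix_data_dataset lam_inj A; congr spectral; apply/funext => j.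
    by rewrite !mxE !modulusM (torus_nm _ tt) t00 conjC1 -(rmorph1 (@ofR R)) modulus_ofR
      normr1 mulr1 mul1r.
  have oA : same_orbit A A2 by apply/asboolP; exists t.
  have UA2 : U A2 by exact: invU oA.
  have fE : f A2 = f A.
    rewrite (equiv _ _ _ tt UA A2E) pt; apply/rowP => j; rewrite mul_mx_diag !mxE.
    case: (boolP (j \in B')) => jB; last by rewrite mulr1.
    have : j \in Z' by move: B'Z; rewrite powersetE => /fintype.subsetP; apply.
    by rewrite inE => /eqP->; rewrite mul0r.
  have A2A : A2 = A by apply: injf; rewrite ?inE.
  have := congr1 (fun X : 'M[C]_n.+1 => X (lf i) 0) A2E.
  rewrite A2A torus_conjE // ti t00 conjC1 mulr1 mulN1r mxE => /eqP.
  by rewrite -subr_eq0 opprK -mulr2n mulrn_eq0.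
rewrite -(leq_exp2l #|Z'| #|Z| (ltnSn 1)) -!card_powerset.
have injchi : {in powerset Z' &, injective chi}.
  move=> B D hB hD e; have [_ [t [tt t0 tl pt]]] := chiP B hB.
  have [_ [s [ts s0 sl ps]]] := chiP D hD.
  have ets : t = s.
    apply: torus_eq => // i; case: (unliftP ord0 i) => [j|] ->; first by rewrite tl sl e.
    by rewrite t0 s0.
  apply/finset.setP => i; apply: sgn_inj.
  by rewrite -!sgn_mx_diag -pt -ps ets.
rewrite -(card_in_imset injchi); apply/subset_leq_card/fintype.subsetP => _ /imsetP[B BZ ->].
by have [] := chiP B BZ.
Qed.

Lemma chart_zeros :
  #|[pred i | f A 0 i == 0]| = #|[pred i | (matrix_data A).2 0 i == 0]|.
Proof.
have := card_zeros_le; have := card_zeros_ge; rewrite /Z /Z' !cardsE => h1 h2.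
by apply/eqP; rewrite eqn_leq h1 h2.
Qed.
End ChartDepth.
End Depth.

(** * The faces of the orbit space *)
Section OrbitSpace.
Local Open Scope sesquilinear_scope.
Local Open Scope quotient_scope.
Variables (R : realType) (n : nat) (lam : 'I_n.+1 -> R).
Hypotheses (n_gt0 : (0 < n)%N) (lam_inj : injective lam).
Local Notation C := (complexes R).
Local Notation lf := (lift ord0).
Local Notation M := (arrow_manifold lam).
Local Notation Q := (orbit_space lam).
Local Notation X := (dataset lam).
Implicit Types (N : {set 'I_n}) (p : {perm 'I_n.+1}) (q : Q).

(** The data of an orbit; the orbit space embeds by it onto the dataset. *)
Definition orbit_data q : data R n := matrix_data (repr q : M).

Lemma orbit_data_proj (A : M) : orbit_data (orbit_proj A) = matrix_data A.
Proof.
apply: (same_orbitP lam_inj (repr (orbit_proj A) : M) A).1.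
by apply/eqquotP; exact: (@reprK _ {eq_quot (@same_orbit R n lam)} _).
Qed.

Lemma orbit_proj_surj q : exists A : M, q = orbit_proj A.
Proof. by exists (repr q); rewrite /orbit_proj reprK. Qed.

Lemma orbit_data_inj : injective orbit_data.
Proof.
move=> q q'; have [A ->] := orbit_proj_surj q; have [B ->] := orbit_proj_surj q';
  rewrite !orbit_data_proj.
by move=> /(same_orbitP lam_inj) AB; apply/eqquotP.
Qed.

Lemma orbit_data_dataset q : X (orbit_data q). Proof. exact: matrix_data_dataset. Qed.

Lemma orbit_data_continuous : continuous orbit_data.
Proof.
apply: (@repr_comp_continuous M {eq_quot (@same_orbit R n lam)} (data R n) (@matrix_data R n lam)).
  exact: matrix_data_continuous.
move=> A B /eqP AB; apply/eqP; apply: (same_orbitP lam_inj A B).1.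
by apply/eqquotP; exact: AB.
Qed.

(** Choose the arms to be the nonnegative square roots of the weights. *)
Lemma section_exists : exists2 S : data R n -> Q,
  forall x, X x -> orbit_data (S x) = x & {within X, continuous S}.
Proof.
pose b (x : data R n) : 'rV[C]_n := \row_i ofR (Num.sqrt (x.2 0 i)).
pose g x : 'M[C]_n.+1 := arrow lam x.1 (b x).
have nb x i : X x -> modulus (b x 0 i) ^+ 2 = x.2 0 i.
  by move=> [_ w0]; rewrite mxE modulus_ofR ger0_norm ?sqrtr_ge0 // sqr_sqrtr.
have gM x : X x -> exists A : M, \val A = g x.
  move=> Xx; apply: arrow_in_manifold => //; have [+ _] := Xx.
  by congr spectral; apply/funext => i; rewrite nb.
have [A0 _] := gM _ (vertex_face lam finset.set0 1%g).1.
have /boolp.choice[s sE] : forall x, exists A : M, X x -> \val A = g x.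
  move=> x; have [Xx|nXx] := pselect (X x); last by exists A0.
  by have [A AE] := gM x Xx; exists A.
exists (fun x => orbit_proj (s x)) => [x Xx|].
  rewrite orbit_data_proj; have [d1 d2 _] := matrix_data_arrow (sE x Xx).
  rewrite [LHS]surjective_pairing d1 d2 [RHS]surjective_pairing; congr (_, _).
  by apply/rowP => i; rewrite mxE nb.
have cg : continuous g.
  move=> x; apply: arrow_continuous; first exact: cvg_fst.
  apply: cts_mx => _ i.
  apply: (@cts_comp _ _ _ (fun y : data R n => Num.sqrt (y.2 0 i)) (@ofR R)).
    apply: (@cts_comp _ _ _ (fun y : data R n => y.2 0 i) Num.sqrt).
      exact: cts_weight.
    exact: sqrt_continuous.
  exact: ofR_continuous.
have cs : {within X, continuous s}.
  apply: (@continuous_comp_initial _ (subspace X) _ (set_val : isospectral_arrow lam -> _) s).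
  apply: (@subspace_eq_continuous _ _ _ (g : subspace X -> _)).
    by move=> x; rewrite inE => Xx; rewrite /= set_valE sE.
  exact: continuous_subspaceT.
move=> x; apply: (@continuous_comp (subspace X) M Q s (@orbit_proj R n lam)); first exact: cs.
exact: pi_continuous.
Qed.

Definition orbit_face N p : set Q := orbit_data @^-1` data_face lam N p.
Definition orbit_stratum N p : set Q := orbit_data @^-1` data_stratum lam N p.

Lemma orbit_stratum_nonempty N p : orbit_stratum N p !=set0.
Proof.
have [S SK _] := section_exists; have [x Ox] := data_stratum_nonempty n_gt0 lam_inj N p.
by exists (S x); rewrite /orbit_stratum /= SK //; case: Ox => -[].
Qed.

(** A point of the stratum of (N', p') has zero weights exactly outside N', at the
    nodes given by p', so that its lying in the face of (N, p) forces the condition. *)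
Lemma orbit_face_le N N' p p' : orbit_face N' p' `<=` orbit_face N p <->
  N' \subset N /\ agree_off N p' p.
Proof.
split=> [sub|[NN pp] q]; last exact: data_face_mono.
have [q Oq] := orbit_stratum_nonempty N' p'; have [Fq oq] := Oq; have [_ fq] := sub q Fq.
have [_ fq'] := Fq.
have off i : i \notin N -> i \notin N'.
  by move=> iN; apply/negP => /oq; rewrite (fq i iN).1 eqxx.
split; first by apply/fintype.subsetP => i; apply: contraTT; exact: off.
by move=> i iN; apply: lam_inj; rewrite -(fq i iN).2 -(fq' i (off i iN)).2.
Qed.

Lemma orbit_stratum_connected N p : connected (orbit_stratum N p).
Proof.
have [S SK cS] := section_exists.
have -> : orbit_stratum N p = S @` data_stratum lam N p.
  apply/seteqP; split=> [q Oq|_ [x Ox <-]].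
    by exists (orbit_data q) => //; apply: orbit_data_inj; rewrite SK //; exact: orbit_data_dataset.
  by rewrite /orbit_stratum /= SK //; case: Ox => -[].
apply: connected_continuous_connected; first exact: data_stratum_connected.
by apply: continuous_subspaceW cS => x [[]].
Qed.

Lemma orbit_face_closed N p : closed (orbit_face N p).
Proof.
have closed_level (h : data R n -> R) (c : R) : (forall x, {for x, continuous h}) ->
    closed [set q | h (orbit_data q) = c].
  move=> ch; apply: (@preimage_closed _ _ (fun q => h (orbit_data q)) [set c]).
    by move=> q _; apply: (@cts_comp _ _ _ orbit_data h); [exact: orbit_data_continuous|exact: ch].
  exact/accessible_closed_set1/hausdorff_accessible/Rhausdorff.
have -> : orbit_face N p = \bigcap_(i in [set i | i \notin N])
    ([set q | (orbit_data q).2 0 i = 0] `&` [set q | (orbit_data q).1 0 i = lam (p (lf i))]).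
  apply/seteqP; split=> [q [_ fq] i iN|q fq]; first exact: fq.
  by split; [exact: orbit_data_dataset|move=> i iN; exact: fq].
apply: closed_bigI => i _; apply: closedI.
  by apply: (closed_level (fun x : data R n => x.2 0 i)) => x; exact: cts_weight.
by apply: (closed_level (fun x : data R n => x.1 0 i)) => x; exact: cts_diag.
Qed.

(** Faces are closed, and the section transports the density of
    [local_faces]. *)
Lemma orbit_stratum_closure N p : closure (orbit_stratum N p) = orbit_face N p.
Proof.
apply/seteqP; split.
  have -> : orbit_face N p = closure (orbit_face N p) by apply/closure_id; exact: orbit_face_closed.
  by apply: closureS => q [].
move=> q Fq B nB; have [S SK cS] := section_exists.
have SD : S (orbit_data q) = q by apply: orbit_data_inj; rewrite SK //; exact: orbit_data_dataset.
have /subspace_continuousP/(_ _ (orbit_data_dataset q)) cSq := cS.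
have nS : within X (nbhs (orbit_data q)) (S @^-1` B).
  have nB' : nbhs (S (orbit_data q)) B by rewrite SD.
  exact: cSq nB'.
have [x [Ox Bx]] := data_face_closure n_gt0 lam_inj Fq nS.
have Xx : X x by case: Ox => -[].
by exists (S x); split; [rewrite /orbit_stratum /= SK|exact: Bx].
Qed.

(** Start from the face with N full, which is the whole dataset, and remove the
    columns of weight zero one by one. *)
Lemma in_data_stratum x : X x -> exists N p, data_stratum lam N p x.
Proof.
move=> Xx; suff H k N p : (#|N| < k)%N -> data_face lam N p x -> exists N p, data_stratum lam N p x.
  apply: (H #|[set: 'I_n]%SET|.+1 [set: 'I_n]%SET 1%g) => //.
  by split=> // i; rewrite finset.in_setT.
elim: k N p => // k IH N p kN Fx.
have [j /andP[jN /eqP wj]|nz] := pickP [pred j | (j \in N) && (x.2 0 j == 0)].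
  have [p' Fx' _] := zero_weight_face lam_inj Fx jN wj.
  by apply: IH Fx'; move: kN; rewrite (cardsD1 j N) jN.
exists N, p; split=> // i iN; have := nz i; by rewrite /= iN => /negbT.
Qed.

Lemma data_stratum_zeros N p x : data_stratum lam N p x -> #|[pred i | x.2 0 i == 0]| = #|~: N|%SET.
Proof.
move=> [[_ fx] ox]; apply: eq_card => i; rewrite inE finset.in_setC.
have [iN|iN] := boolP (i \in N); first by rewrite (negPf (ox i iN)).
by rewrite (fx i iN).1 eqxx.
Qed.

Lemma common_stratum_face N N' p p' q : orbit_stratum N p q -> orbit_stratum N' p' q ->
  orbit_face N p `<=` orbit_face N' p'.
Proof.
move=> [[_ f1] o1] [[_ f2] o2]; apply/orbit_face_le.
have NN i : i \notin N' -> i \notin N.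
  by move=> iN; apply/negP => /o1; rewrite (f2 i iN).1 eqxx.
split; first by apply/fintype.subsetP => i; apply: contraTT; exact: NN.
by move=> i iN; apply: lam_inj; rewrite -(f1 i (NN i iN)).2 -(f2 i iN).2.
Qed.

(** A given chart counts the zero weights by [chart_zeros].  Conversely the chart
    of [chart_exists] descends to the orbit space by taking moduli at any point of the
    orbit in U. *)
Lemma depthE k q : depth_stratum (@orbit_atlas R n lam) k q <->
  #|[pred i | (orbit_data q).2 0 i == 0]| = k.
Proof.
split=> [[[cU cx] [[U [f [chart UE fE]]] cq <-]]|<-].
  move: cq; rewrite UE => -[A UA <-]; rewrite orbit_data_proj.
  rewrite -(chart_zeros lam_inj chart UA); apply: eq_card => i; rewrite !inE.
  have e : ofR (cx (orbit_proj A) ord0 i) = `|f A ord0 i| := fE A UA i.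
  by rewrite -normr_eq0 -e ofR_eq0.
have [A ->] := orbit_proj_surj q; rewrite orbit_data_proj.
have [U [f [chart UA fz]]] := chart_exists n_gt0 lam_inj A.
exists (@orbit_proj R n lam @` U, fun q => \row_i modulus (f (xget A (U `&` [set B |
  orbit_proj B = q])) 0 i)).
have chartE B i : U B -> modulus (f (xget A (U `&` [set B' | orbit_proj B' = orbit_proj
  B])) 0 i) = modulus (f B 0 i).
  move=> UB; have : (U `&` [set B' | orbit_proj B' = orbit_proj B])
      (xget A (U `&` [set B' | orbit_proj B' = orbit_proj B])).
    by apply: xgetPex; exists B.
  set B' := xget _ _ => -[UB' /= BB'].
  have /asboolP[t tt BE] : same_orbit B B' by apply/(same_orbitP lam_inj);
    rewrite -!orbit_data_proj BB'.
  have [_ _ _ _ [psi [psiT _ _ _] equiv]] := chart.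
  have tp : torus (psi t) by rewrite -psiT; exists t.
  have /torusP[d _] := tp.
  rewrite (equiv _ _ _ tt UB BE) mxE (bigD1 i) //= big1 ?addr0.
    by rewrite modulusM (torus_nm _ tp) mulr1.
  by move=> j ji; rewrite d ?mulr0.
split=> /=.
- exists U, f; split=> // B UB i /=; rewrite mxE.
  by rewrite chartE //; exact: ofR_modulus.
- by exists A.
by apply: eq_card => i; rewrite !inE mxE chartE // modulus_eq0 fz.
Qed.

(** Within the points of depth k, a stratum is the trace of its face, which is
    closed, and its complement is the trace of the finite union of the other faces with as
    many columns, which is closed too. *)
Lemma depth_component k q N p : depth_stratum (@orbit_atlas R n lam) k q -> orbit_stratum N p q ->
  connected_component (depth_stratum (@orbit_atlas R n lam) k) q = orbit_stratum N p.
Proof.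
move=> /depthE dq Oq; set D := depth_stratum _ _.
have kE : #|~: N|%SET = k by rewrite -dq (data_stratum_zeros Oq).
have OD : orbit_stratum N p `<=` D by move=> q' Oq'; apply/depthE; rewrite (data_stratum_zeros Oq').
apply/seteqP; split; last first.
  by apply: connected_component_max => //; exact: orbit_stratum_connected.
set K := connected_component _ _.
have KD : K `<=` D by exact: connected_component_sub.
have Kq : K q by apply: connected_component_refl; exact: OD.
have FD N' p' q' : D q' -> orbit_face N' p' q' -> #|~: N'|%SET = k -> orbit_stratum N' p' q'.
  move=> /depthE dq' Fq' kE'; split=> // i iN'.
  have zs : [set j | j \notin N']%SET \subset [set j | (orbit_data q').2 0 j == 0]%SET.
    by apply/fintype.subsetP => j; rewrite !inE => jN'; rewrite (Fq'.2 j jN').1.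
  have /eqP zE : [set j | j \notin N']%SET == [set j | (orbit_data q').2 0 j == 0]%SET.
    rewrite eqEcard zs /= cardsE dq' -kE'; apply: eq_leq; apply: eq_card => j.
    by rewrite !inE.
  have : i \notin [set j | (orbit_data q').2 0 j == 0]%SET by rewrite -zE inE iN'.
  by rewrite inE.
(* The faces of the same depth which avoid q. *)
pose other (z : {set 'I_n} * {perm 'I_n.+1}) : bool :=
  (#|~: z.1|%SET == k) && ~~ `[< orbit_face z.1 z.2 q >].
pose G := \bigcup_(z in [set z | other z]) orbit_face z.1 z.2.
have cG : closed G.
  by apply: closed_bigcup => [|z _]; [exact: finite_finset|exact: orbit_face_closed].
have KF : K `&` orbit_face N p = K.
  apply: component_connected.
  - by exists q; split=> //; case: Oq.
  - exists (~` G); first exact: closed_openC.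
    apply/seteqP; split=> q' [Kq' h]; split=> //.
      move=> [z /andP[/eqP zk /asboolPn zq] zq'].
      have Oz := FD _ _ _ (KD _ Kq') zq' zk.
      have O1 := FD _ _ _ (KD _ Kq') h kE.
      apply: zq; apply: (common_stratum_face O1 Oz); by case: Oq.
    have [N' [p' O']] := in_data_stratum (orbit_data_dataset q').
    have k' : #|~: N'|%SET = k by rewrite -(data_stratum_zeros O'); apply/depthE; exact: KD.
    have [zq|zq] := pselect (orbit_face N' p' q).
      have O2 := FD _ _ _ (KD _ Kq) zq k'.
      by apply: (common_stratum_face O2 Oq); case: O'.
    exfalso; apply: h; exists (N', p'); last by case: O'.
    by rewrite /other /= k' eqxx; apply/asboolPn.
  - by exists (orbit_face N p) => //; exact: orbit_face_closed.
move=> q' Kq'; apply: FD => //; first exact: KD.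
by have [_] : (K `&` orbit_face N p) q' by rewrite KF.
Qed.

Lemma orbit_facesE : @orbit_faces R n lam = [set F | exists N p, F = orbit_face N p].
Proof.
apply/seteqP; split=> [_ [_ [k [q dq ->]] <-]|_ [N [p ->]]].
  have [N [p Oq]] := in_data_stratum (orbit_data_dataset q).
  by exists N, p; rewrite (depth_component dq Oq) orbit_stratum_closure.
have [q Oq] := orbit_stratum_nonempty N p.
exists (orbit_stratum N p); last exact: orbit_stratum_closure.
have dq : depth_stratum (@orbit_atlas R n lam) #|~: N|%SET q.
  by apply/depthE; rewrite (data_stratum_zeros Oq).
by exists #|~: N|%SET, q => //; rewrite (depth_component dq Oq).
Qed.
End OrbitSpace.

(** * Clusters of the star graph *)
Section StarClusters.
Variable n : nat.
Local Notation lf := (lift ord0).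
Local Notation V := 'I_n.+1.
Implicit Types (N : {set 'I_n}) (p q : {perm V}) (e : rel V).

(** The block of the centre in the partition given by the leaves N. *)
Definition hub N : {set V} := (ord0 |: lf @: N)%SET.
Definition star_sub N : rel V :=
  fun x y => [&& star_graph x y, x \in hub N & y \in hub N].
Definition leaves e : {set 'I_n} := [set i | e ord0 (lf i)]%SET.

Lemma in_hub0 N : ord0 \in hub N. Proof. exact: setU11. Qed.

Lemma in_hub_lf N i : (lf i \in hub N) = (i \in N).
Proof. by rewrite in_setU1 eq_sym (negPf (neq_lift _ _)) (mem_imset _ _ lift_inj). Qed.

Lemma star_sub_subgraph N : subgraph (@star_graph n) (star_sub N).
Proof.
split=> [x y|x y /and3P[]//]; rewrite /star_sub /star_graph eq_sym.
by case: (x \in _); case: (y \in _); rewrite ?andbF.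
Qed.

Lemma leaves_star_sub N : leaves (star_sub N) = N.
Proof.
apply/finset.setP => i; rewrite finset.in_set /star_sub /star_graph in_hub0 in_hub_lf eqxx.
by rewrite [lf i == _]eq_sym (negPf (neq_lift _ _)).
Qed.

Definition linked N (x y : V) := (x == y) || (x \in hub N) && (y \in hub N).

Lemma connect_star e x y : subgraph (@star_graph n) e ->
  connect e x y = linked (leaves e) x y.
Proof.
move=> [se sub].
have lf0 i : (lf i == ord0) = false by rewrite eq_sym (negPf (neq_lift _ _)).
have eh a b : e a b -> (a \in hub (leaves e)) && (b \in hub (leaves e)).
  move=> ab; have := sub _ _ ab; rewrite /star_graph.
  case: (unliftP ord0 a) ab => [i|] ->; case: (unliftP ord0 b) => [j|] ->;
    rewrite ?eqxx ?lf0 // => ab _.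
  - by rewrite in_hub0 in_hub_lf finset.in_set se ab.
  - by rewrite in_hub0 in_hub_lf finset.in_set ab.
apply/idP/idP => [/connectP[w + ->]|].
  elim: w x => [|z w IH] x /=; first by rewrite /linked eqxx.
  move=> /andP[/eh/andP[xh zh] /IH]; rewrite /linked xh.
  by case/orP => [/eqP<-|/andP[_ ->]]; rewrite ?zh ?orbT.
have c0 z : z \in hub (leaves e) -> connect e ord0 z.
  case: (unliftP ord0 z) => [i|] ->; last by rewrite connect0.
  by rewrite in_hub_lf finset.in_set => ?; exact: connect1.
case/orP => [/eqP->|/andP[xh yh]]; first exact: connect0.
apply: connect_trans (c0 y yh).
by rewrite (sym_connect_sym se); exact: c0.
Qed.

(** The blocks are the hub of N and the singletons outside of it. *)
Definition star_partition N : {set {set V}} := components (star_sub N).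

Lemma components_star e : subgraph (@star_graph n) e -> components e = star_partition (leaves e).
Proof.
move=> se; rewrite /star_partition /components.
have -> : connect e = connect (star_sub (leaves e)); last by [].
apply/funext => x; apply/funext => y; rewrite connect_star // connect_star ?leaves_star_sub //.
exact: star_sub_subgraph.
Qed.

Lemma in_star_partition N (B : {set V}) : reflect (exists x,
  B = [set y | linked N x y]%SET) (B \in star_partition N).
Proof.
have E x : [set y in [set: V] | connect (star_sub N) x y]%SET = [set y | linked N x y]%SET.
  apply/finset.setP => y; rewrite !finset.in_set /= connect_star ?leaves_star_sub //.
  exact: star_sub_subgraph.
apply: (iffP imsetP) => [[x _ ->]|[x ->]]; exists x => //; rewrite -E //.
Qed.

(** The set N is recovered as the leaves in the block of the centre. *)
Lemma star_partition_inj : injective star_partition.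
Proof.
suff H N i : i \in N <-> exists2 B, B \in star_partition N & (ord0 \in B) && (lf i \in B).
  move=> N N' e; apply/finset.setP => i; apply/idP/idP => /H; last by rewrite -e => /H.
  by rewrite e => /H.
split=> [iN|[_ /in_star_partition[x ->]]].
  exists [set y | linked N ord0 y]%SET; first by apply/in_star_partition; exists ord0.
  by rewrite !finset.in_set /linked eqxx in_hub0 in_hub_lf iN orbT.
rewrite !finset.in_set /linked in_hub_lf => /andP[/orP[/eqP->|/andP[xh _]]].
  by rewrite (negPf (neq_lift _ _)) => /andP[].
case/orP => [/eqP e|/andP[]//]; by move: xh; rewrite e in_hub_lf.
Qed.

Lemma block_permP N (s : {perm V}) :
  block_perm (star_partition N) s <-> forall i, i \notin N -> s (lf i) = lf i.
Proof.
split=> [bs i iN|fs _ /in_star_partition[x ->]].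
  have := bs [set lf i]%SET; rewrite imset_set1 => H.
  apply/set1_inj/H/in_star_partition; exists (lf i); apply/finset.setP => y.
  by rewrite finset.in_set1 finset.in_set /linked in_hub_lf (negPf iN) orbF eq_sym.
apply/eqP; rewrite eqEcard card_imset ?leqnn ?andbT; last exact: perm_inj.
have sh y : y \in hub N -> s y \in hub N.
  move=> yh; have [j sy|->] := unliftP ord0 (s y); last exact: in_hub0.
  rewrite sy in_hub_lf; apply: contraT => jN; have := fs j jN.
  by rewrite -sy => /(@perm_inj _ s) ysy; move: yh; rewrite -ysy sy in_hub_lf (negPf jN).
apply/fintype.subsetP => _ /imsetP[y + ->]; rewrite !finset.in_set /linked.
case/orP => [/eqP<-|/andP[xh yh]]; last by rewrite xh sh ?orbT.
have [xh|xh] := boolP (x \in hub N); first by rewrite sh ?orbT.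
case: (unliftP ord0 x) xh => [i ->|->]; last by rewrite in_hub0.
by rewrite in_hub_lf => /fs->; rewrite eqxx.
Qed.

Definition perm_ffun p : {ffun V -> V} := [ffun x => p x].

Lemma perm_ffun_inj : injective perm_ffun.
Proof. by move=> p q /ffunP e; apply/permP => x; have := e x; rewrite !ffunE. Qed.

(** Permuting the block of the centre is free, so that a class of equivalent
    bijections is given by the values outside N. *)
Lemma partition_equivP N (f : {ffun V -> V}) p :
  partition_equiv (star_partition N) f (perm_ffun p) <->
  exists2 q, f = perm_ffun q & agree_off N q p.
Proof.
split=> [[s /block_permP bs fE]|[q -> qp]].
  exists (s * p)%g; first by apply/ffunP => x; rewrite fE !ffunE permM.
  by move=> i iN; rewrite permM bs.
exists (q * p^-1)%g => [|x]; last by rewrite !ffunE permM permKV.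
by apply/block_permP => i iN; rewrite permM qp // permK.
Qed.

Definition star_cluster N p : Defs.cluster V V :=
  (star_partition N, [set f | partition_equiv (star_partition N) f (perm_ffun p)]).

Lemma cluster_permutohedronE :
  @cluster_permutohedron V V (@star_graph n) = [set c | exists N p, c = star_cluster N p].
Proof.
apply/seteqP; split=> [[c1 c2] [e [f [se bf /= -> ->]]]|_ [N [p ->]]].
  exists (leaves e), (perm (bij_inj bf)); rewrite /star_cluster (components_star se).
  suff -> : perm_ffun (perm (bij_inj bf)) = f by [].
  by apply/ffunP => x; rewrite ffunE permE.
exists (star_sub N), (perm_ffun p); split=> //; first exact: star_sub_subgraph.
by exists (fun x => (p^-1)%g x) => x; rewrite ffunE ?permK ?permKV.
Qed.

Lemma star_cluster_eq N p p' : agree_off N p p' -> star_cluster N p = star_cluster N p'.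
Proof.
move=> pp; congr (_, _); apply/seteqP; split=> f /partition_equivP[q fq qp];
  by apply/partition_equivP; exists q => // i iN; rewrite qp // pp.
Qed.

(** Both sides compare the bijections modulo the larger partition; the subgraphs
    with leaves N' and N realize the comparison. *)
Lemma star_cluster_le N N' p p' : cluster_le (@star_graph n) (star_cluster N' p')
  (star_cluster N p) <->
  N' \subset N /\ agree_off N p' p.
Proof.
split=> [[e' [e1 [s1 s' sub [/= c' c1] [q' [q [Hq' Hq H]]]]]]|[NN pp]].
  have eN' : N' = leaves e' by apply: star_partition_inj; rewrite c' components_star.
  have eN : N = leaves e1 by apply: star_partition_inj; rewrite c1 components_star.
  have NN : N' \subset N.
    by rewrite eN eN'; apply/fintype.subsetP => i; rewrite !finset.in_set; exact: sub.
  split=> // i iN.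
  have iN' : i \notin N' by apply: contra iN; exact: (fintype.subsetP NN).
  have /partition_equivP[a' aE' ap'] := Hq'; have /partition_equivP[a aE ap] := Hq.
  move: H; rewrite aE' => /partition_equivP[b bE ba].
  have ab : a = b by apply: perm_ffun_inj; rewrite -aE -bE.
  by rewrite -ap' // -ba // -ab ap.
exists (star_sub N'), (star_sub N); split.
- exact: star_sub_subgraph.
- exact: star_sub_subgraph.
- move=> x y /and3P[xy xh yh]; rewrite /star_sub xy.
  have hh z : z \in hub N' -> z \in hub N.
    case: (unliftP ord0 z) => [i|] ->; rewrite ?in_hub0 // !in_hub_lf.
    exact: (fintype.subsetP NN).
  by rewrite !hh.
- by [].
exists (perm_ffun p'), (perm_ffun p); split.
- by apply/partition_equivP; exists p'.
- by apply/partition_equivP; exists p.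
- by apply/partition_equivP; exists p => // i iN; rewrite pp.
Qed.
End StarClusters.

Theorem mainTheorem5 (R : realType) (n : nat) (hn : (1 <= n)%N)
    (lam : 'I_n.+1 -> R)
    (hlam : forall i j : 'I_n.+1, (i < j)%N -> lam i < lam j) :
  poset_isomorphic
    (@orbit_faces R n lam) (fun F G => F `<=` G)
    (@cluster_permutohedron 'I_n.+1 'I_n.+1 (@star_graph n))
    (@cluster_le 'I_n.+1 'I_n.+1 (@star_graph n)).
Proof.
have lam_inj : injective lam.
  move=> i j e; apply/val_inj; case: (ltngtP i j) => // /hlam; by rewrite e ltxx.
(* A face does not determine p, but it determines the cluster of p. *)
have eqFQ N N' p p' : @orbit_face R n lam N p = @orbit_face R n lam N' p' ->
  star_cluster N p = star_cluster N' p'.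
  move=> e; have [NN pp] : N \subset N' /\ agree_off N' p p'.
    by apply/(orbit_face_le hn lam_inj); rewrite e.
  have [NN' _] : N' \subset N /\ agree_off N p' p.
    by apply/(orbit_face_le hn lam_inj); rewrite e.
  have eN : N = N' by apply/eqP; rewrite finset.eqEsubset NN NN'.
  by rewrite -eN in pp *; exact: star_cluster_eq.
have /boolp.choice[f fE] : forall F : set (orbit_space lam), exists c,
    forall N p, F = @orbit_face R n lam N p -> c = star_cluster N p.
  move=> F; have [[N [p FE]]|no] := pselect (exists N p, F = @orbit_face R n lam N p).
    by exists (star_cluster N p) => N' p' FE'; apply: eqFQ; rewrite -FE.
  by exists (star_cluster finset.set0 1%g) => N p FE; case: no; exists N, p.
rewrite (orbit_facesE hn lam_inj) cluster_permutohedronE.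
exists f; last first.
  move=> _ _ [N' [p' ->]] [N [p ->]].
  rewrite (fE _ N' p') // (fE _ N p) //.
  by rewrite orbit_face_le // star_cluster_le.
split.
- by move=> _ [N [p ->]]; exists N, p; exact: fE.
- move=> F G /set_mem[N' [p' ->]] /set_mem[N [p ->]].
  rewrite (fE _ N' p') // (fE _ N p) // => e.
  have le_refl M q : cluster_le (@star_graph n) (star_cluster M q) (star_cluster M q) by
    apply/star_cluster_le.
  apply/seteqP; split; apply/(orbit_face_le hn lam_inj); apply/star_cluster_le;
    rewrite e; exact: le_refl.
- by move=> _ [N [p ->]]; exists (@orbit_face R n lam N p); [exists N, p|exact: fE].
Qed.
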